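(* For every integer $n>10$, $g\big[\mathbf{CP}_n(\mathbb{R})\big]\ge 1.0045\,n$. Moreover, $\limsup_{n\to\infty} g\big[\mathbf{CP}_n(\mathbb{R})\big]/n \ge 3.317$.
   Context: For an $n\times n$ complex matrix $A=(a_{i,j})$, Gaussian elimination without pivoting is the recursion $a^{(1)}_{i,j}=a_{i,j}$ ($1\le i,j\le n$) and $a^{(k+1)}_{i,j}=a^{(k)}_{i,j}-a^{(k)}_{i,k}a^{(k)}_{k,j}/a^{(k)}_{k,k}$ for $k+1\le i,j\le n$, $k=1,\dots,n-1$, which is defined when all pivots $a^{(k)}_{k,k}$ are nonzero. The growth factor is $g(A)=\max_{i,j,k}|a^{(k)}_{i,j}|/\max_{i,j}|a_{i,j}|$. For $S\subseteq\mathbb{C}$, $\mathbf{CP}_n(S)$ (completely pivoted matrices) is the set of invertible $A\in S^{n\times n}$ for which Gaussian elimination without pivoting is defined and $|a^{(k)}_{i,j}|\le|a^{(k)}_{k,k}|$ for all $k$ and all $i,j\ge k$. For a set $\mathbf{X}$ of matrices, $g[\mathbf{X}]=\sup_{A\in\mathbf{X}}g(A)$. (The result is established with computer-assisted, exactly verified examples.) *)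

(* Defs.v *)
From HB Require Import structures.
From mathcomp Require Import all_boot all_order all_algebra.
From mathcomp Require Import all_classical all_reals.
From mathcomp Require Import ereal topology normedtype sequences.
Unset Strict Implicit. Unset Printing Implicit Defensive.
Import Order.TTheory GRing.Theory Num.Theory.
Local Open Scope ring_scope.

Section GE.
Variable R : realType.

(* entries of an n x n matrix as a function of 0-based nat indices (0 outside) *)
Definition mxf {n : nat} (A : 'M[R]_n) (i j : nat) : R :=
  oapp (fun i' : 'I_n => oapp (fun j' : 'I_n => A i' j') 0 (insub j)) 0 (insub i).

(* gef a k = a^{(k+1)} of the paper (0-based indices): the step-k update
   is applied to entries i,j > k; other entries are kept. *)
Fixpoint gef (a : nat -> nat -> R) (k : nat) : nat -> nat -> R :=
  match k with
  | 0 => a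
  | k'.+1 => let b := gef a k' in
      fun i j => if (k' < i)%N && (k' < j)%N
                 then b i j - b i k' * b k' j / b k' k' else b i j
  end.

Definition ge {n : nat} (A : 'M[R]_n) := gef (mxf A).

Definition ge_defined {n : nat} (A : 'M[R]_n) : Prop :=
  forall k : nat, (k < n)%N -> ge A k k k != 0.

Definition growth {n : nat} (A : 'M[R]_n) : R :=
  (\big[Num.max/0]_(k < n) \big[Num.max/0]_(i < n)
     \big[Num.max/0]_(j < n | (k <= i)%N && (k <= j)%N) `|ge A k i j|)
  / (\big[Num.max/0]_(i < n) \big[Num.max/0]_(j < n) `|A i j|).

Definition CP (n : nat) : set 'M[R]_n :=
  [set A | A \in unitmx /\ ge_defined A /\
     (forall k i j : nat, (k < n)%N -> (k <= i < n)%N -> (k <= j < n)%N ->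
        `|ge A k i j| <= `|ge A k k k|)].

Definition gCP (n : nat) : \bar R :=
  ereal_sup [set (growth A)%:E | A in CP n].

End GE.

(* Main.v *)
(* A completely pivoted matrix of order n with growth at least r yields one of
   order n + 1 with growth r (border it by a first pivot) and one of order 2n
   with growth 2r (take the Kronecker product with [[1, 1], [1, -1]]).  The
   limsup thus follows from a single matrix of order m with growth at least
   3.317 m, and the linear lower bound from finitely many small matrices.  Such
   a matrix is given by scaled integer LU factors: every intermediate matrix of
   the elimination is then an exact partial sum of integer rank-one matrices, so
   complete pivoting is decided by integer arithmetic.  The factors were obtained
   by rounding numerical solutions (m = 120) of the growth maximization problem. *)
From Stdlib Require Import ZArith.
Require Import Defs.
From mathcomp Require Import all_boot all_order all_algebra.
From mathcomp Require Import all_classical all_reals.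
From mathcomp Require Import ereal topology normedtype sequences.
From mathcomp Require Import ssrZ zify ring.
Import Order.TTheory GRing.Theory Num.Theory.
Local Open Scope ring_scope.
Set Implicit Arguments.
Unset Strict Implicit.

(** Growth enters only through the ratio of the last pivot to the first entry. Complete pivoting
    makes the first entry the largest one, and the last pivot bounds the numerator from below, so
    this ratio never exceeds the growth factor; unlike the full maximum, it is carried along exactly
    by both constructions. The obstacle is parity: from order n and ratio c n, doubling followed by
    one bordering reaches order 2n + 1 with ratio only 2 c n. The induction therefore runs on the
    stronger bound c (n + 1), which reproduces itself at 2n and at 2n + 1. Matrices meeting the
    stronger bound are supplied for the orders 16 to 31; the orders 11 to 15 get the bound c n only.
    The matrix of order 11 has ratio 271560 / 24576, about 1.00453 times 11, and no other matrix of
    the linear bound is closer to its target: this fixes the constant 1.0045. The limsup meets no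
    parity problem, since the orders 120 * 2 ^ k suffice for it. *)

Section SchurComplement.
Variable R : realType.
Implicit Types f g : nat -> nat -> R.

(** * Schur complements of infinite arrays, and complete pivoting *)

Definition schur f (i j : nat) : R := f i.+1 j.+1 - f i.+1 0%N * f 0%N j.+1 / f 0%N 0%N.

(* Indices restart at 0 in every Schur complement: [iter k schur f i j] is
   [gef R f k (k + i) (k + j)]. *)
Fixpoint cp (n : nat) f : Prop :=
  if n is n'.+1 then
    [/\ f 0%N 0%N != 0,
        forall i j, (i < n)%N -> (j < n)%N -> `|f i j| <= `|f 0%N 0%N|
      & cp n' (schur f)]
  else True.

(** Order 0 gets the junk value [f 0 0]; [cp_gCP], which turns this number into a bound on growth,
    excludes that order. *)
Definition last_pivot (n : nat) f : R := iter n.-1 schur f 0%N 0%N.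

Lemma last_pivotSS n f : last_pivot n.+2 f = last_pivot n.+1 (schur f).
Proof. by rewrite /last_pivot /= -iterS iterSr. Qed.

(** Arrays are infinite, while a matrix determines only a corner of one. This lemma and the next two
    localise equality: elimination in order [n] reads nothing outside that corner. *)
Lemma eq_schur n f g :
  (forall i j, (i < n.+1)%N -> (j < n.+1)%N -> f i j = g i j) ->
  forall i j, (i < n)%N -> (j < n)%N -> schur f i j = schur g i j.
Proof. by move=> fg i j ilt jlt; rewrite /schur !fg. Qed.

Lemma eq_cp n f g : (forall i j, (i < n)%N -> (j < n)%N -> f i j = g i j) ->
  cp n f -> cp n g.
Proof.
elim: n f g => [//|n IHn] f g fg [f0 fle cpf]; split.
- by rewrite -fg.
- by move=> i j ilt jlt; rewrite -!fg // fle.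
- exact: IHn (eq_schur fg) cpf.
Qed.

Lemma eq_last_pivot n f g :
  (forall i j, (i < n.+1)%N -> (j < n.+1)%N -> f i j = g i j) ->
  last_pivot n.+1 f = last_pivot n.+1 g.
Proof.
elim: n f g => [|n IHn] f g fg; first by rewrite /last_pivot /= fg.
by rewrite !last_pivotSS; apply: IHn; exact: eq_schur.
Qed.

Lemma cp_iter n f k : (k < n)%N -> cp n f -> cp (n - k) (iter k schur f).
Proof.
elim: k n f => [|k IHk] [|n] f // klt cpf.
by case: cpf => _ _ cpf; rewrite subSS iterSr; exact: IHk.
Qed.

(** [gef] keeps absolute indices and leaves finished rows and columns in place, whereas [schur]
    drops them. On the active block the two differ only by the shift [k]. *)
Lemma gef_schur f k i j : (k <= i)%N -> (k <= j)%N ->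
  gef R f k i j = iter k schur f (i - k)%N (j - k)%N.
Proof.
elim: k i j => [|k IHk] i j ki kj; first by rewrite !subn0.
rewrite /= ki kj !IHk ?(ltnW ki) ?(ltnW kj) //.
by rewrite !subnn -(subnSK ki) -(subnSK kj).
Qed.

Lemma mxfE n f i j : (i < n)%N -> (j < n)%N ->
  mxf R (\matrix_(i < n, j < n) f i j) i j = f i j.
Proof. by move=> il jl; rewrite /mxf !insubT /= mxE. Qed.

(** This yields invertibility from the pivots alone. Column 0 of x f = 0 expresses the sum of
    x_{i+1} f_{i+1,0} as - x_0 f_{0,0}; substituting this in the other columns puts the tail of x in
    the left kernel of the Schur complement. By induction the tail vanishes, and then x_0 f_{0,0} =
    0 with a nonzero pivot. *)
Lemma cp_kernel n f (x : nat -> R) : cp n f ->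
  (forall j, (j < n)%N -> \sum_(i < n) x i * f i j = 0) ->
  forall i, (i < n)%N -> x i = 0.
Proof.
elim: n f x => [//|n IHn] f x [f0 fle cpf] xf.
have x0 : forall i, (i < n)%N -> x i.+1 = 0.
  apply: (IHn (schur f) (fun i => x i.+1) cpf) => j jn.
  have := xf j.+1 jn; have := xf 0%N isT.
  rewrite !big_ord_recl /= => e0 ej.
  have -> : \sum_(i < n) x i.+1 * schur f i j =
      \sum_(i < n) x i.+1 * f i.+1 j.+1
      - (\sum_(i < n) x i.+1 * f i.+1 0%N) * f 0%N j.+1 / f 0%N 0%N.
    rewrite !mulr_suml -sumrB; apply: eq_bigr => i _.
    by rewrite /schur mulrBr !mulrA.
  have -> : \sum_(i < n) x i.+1 * f i.+1 j.+1 = - (x 0%N * f 0%N j.+1).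
    by apply/eqP; rewrite -addr_eq0 addrC; apply/eqP.
  have -> : \sum_(i < n) x i.+1 * f i.+1 0%N = - (x 0%N * f 0%N 0%N).
    by apply/eqP; rewrite -addr_eq0 addrC; apply/eqP.
  by field.
case=> [_|i /x0 //].
have := xf 0%N isT; rewrite big_ord_recl big1 ?addr0 => [/eqP|i _].
  by rewrite mulf_eq0 (negbTE f0) orbF => /eqP.
by rewrite /= /bump /= add1n x0 // mul0r.
Qed.

End SchurComplement.

Arguments schur {R} f i j.

(** * Growth of matrices given by arrays; bordering and doubling *)

Section Reach.
Variable R : realType.
Implicit Types f g : nat -> nat -> R.

Lemma cp_pivot n f k : (k < n)%N -> cp n f -> iter k schur f 0%N 0%N != 0.
Proof.
move=> klt /(cp_iter klt).
by case: (n - k)%N (subn_gt0 k n) => [|m]; rewrite klt // => _ [].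
Qed.

Lemma cp_le n f k i j : (k < n)%N -> (i < n - k)%N -> (j < n - k)%N -> cp n f ->
  `|iter k schur f i j| <= `|iter k schur f 0%N 0%N|.
Proof.
move=> klt; case: (n - k)%N (@cp_iter R n f k klt) => [|m] // cpf il jl.
by move=> /cpf[_ + _]; apply.
Qed.

(** [mxf] is 0 outside the matrix, where [f] is arbitrary. The k-th elimination stage at an entry
    inside the matrix only reads entries inside the matrix, so the difference is never seen. *)
Lemma geE n f k i j : (k <= i < n)%N -> (k <= j < n)%N ->
  ge R (\matrix_(i < n, j < n) f i j) k i j = iter k schur f (i - k)%N (j - k)%N.
Proof.
move=> /andP[ki il] /andP[kj jl]; rewrite /ge gef_schur //.
(* The truncated differences become fresh indices [i] and [j] with [k + i < n] and [k + j < n]. This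
   form survives the induction on [k], because one [schur] step lowers [k] and raises the indices by
   at most one. *)
have [il' jl'] : (i - k + k < n)%N /\ (j - k + k < n)%N by rewrite !subnK.
move: (i - k)%N (j - k)%N il' jl' => {ki il kj jl}i {}j; rewrite ![(_ + k)%N]addnC.
elim: k i j => [|k IHk] i j il jl /=; first by rewrite mxfE.
have kn : (k < n)%N by lia.
by rewrite /schur !IHk //; lia.
Qed.

(** Complete pivoting at step 0 makes [f 0 0] an entry of largest modulus, so it controls the
    denominator of [growth]; the last pivot is one of the entries under the maximum in the
    numerator. *)
Lemma cp_gCP n f (r : R) : (0 < n)%N -> 0 <= r -> cp n f ->
  r * `|f 0%N 0%N| <= `|last_pivot n f| -> (r%:E <= gCP R n)%E.
Proof.
case: n => [//|n] _ r0 cpf rf.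
set A : 'M[R]_n.+1 := \matrix_(i, j) f i j.
have CPA : CP R n.+1 A.
  split; [|split].
  - rewrite -row_free_unit -kermx_eq0; apply/eqP/row_matrixP => i.
    rewrite row0; apply/rowP => j; rewrite [RHS]mxE.
    (* [kermx] is the left kernel, which matches [cp_kernel]. A row of it is read as a sequence over
       [nat]; [inord] is harmless, since only indices below the order matter. *)
    pose x k := row i (kermx A) 0 (inord k).
    suff : x j = 0 by rewrite /x inord_val.
    apply: (cp_kernel cpf) => // k kn.
    have /(congr1 (fun M : 'M[R]_n.+1 => M i (Ordinal kn))) := mulmx_ker A.
    rewrite !mxE => kerA; rewrite -[RHS]kerA; apply: eq_bigr => l _.
    by rewrite /x !mxE inord_val.
  - by move=> k kn; rewrite geE ?leqnn ?kn // !subnn (cp_pivot kn cpf).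
  - move=> k i j kn ikn jkn; rewrite !geE ?leqnn ?kn // !subnn.
    by apply: (cp_le kn) => //; lia.
apply: (le_trans _ (ereal_sup_ubound _)); last by exists A.
have f0 : f 0%N 0%N != 0 by case: cpf.
(* This inequality makes the denominator positive. The opposite one, from complete pivoting at step
   0, is what bounds the quotient below. *)
have maxA : `|f 0%N 0%N| <= \big[Num.max/0]_i \big[Num.max/0]_j `|A i j|.
  apply: (le_trans _ (le_bigmax _ _ ord0)).
  by apply: (le_trans _ (le_bigmax _ _ ord0)); rewrite mxE.
rewrite lee_fin /growth ler_pdivlMr ?(lt_le_trans _ maxA) ?normr_gt0 //.
apply: (le_trans (ler_wpM2l r0 (_ : _ <= `|f 0%N 0%N|))).
  apply: bigmax_le => // i _; apply: bigmax_le => // j _.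
  by rewrite mxE; case: cpf => _ + _; apply.
apply: (le_trans rf); rewrite /last_pivot /=.
(* The order is [n.+1], so the last pivot is the entry with k = i = j = n; this index is then chosen
   in all three nested maxima. *)
have := @geE n.+1 f n n n; rewrite leqnn ltnSn subnn => /(_ isT isT) <-.
do 2!apply: (bigmax_sup ord_max) => //.
by apply: (bigmax_sup ord_max); rewrite ?leqnn.
Qed.

(** The quotient is cleared of its denominator, so [r] can be rescaled without side conditions. The
    witness is an array and not a matrix, since bordering and doubling change the order. *)
Definition reach (n : nat) (r : R) := exists2 f, cp n f &
  r * `|f 0%N 0%N| <= `|last_pivot n f|.

Lemma reach_gCP n r : (0 < n)%N -> 0 <= r -> reach n r -> (r%:E <= gCP R n)%E.
Proof. by move=> n0 r0 [f]; exact: cp_gCP. Qed.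

Lemma reach_le n r r' : r' <= r -> reach n r -> reach n r'.
Proof.
by move=> rr' [f cpf rf]; exists f => //; rewrite (le_trans _ rf) // ler_wpM2r.
Qed.

(** The block diagonal matrix with blocks [f 0 0] and [f]. Repeating [f 0 0] as the new first pivot
    keeps complete pivoting, because it dominates [f], and keeps the ratio, because the first entry
    is unchanged. *)
Definition border f (i j : nat) : R :=
  if i is i'.+1 then if j is j'.+1 then f i' j' else 0
  else if j is j'.+1 then 0 else f 0%N 0%N.

Lemma schur_border f : schur (border f) = f.
Proof.
by apply/funext => i; apply/funext => j; rewrite /schur /= !mul0r subr0.
Qed.

(** Order 0 is left out, because the new pivot [f 0 0] is known to be nonzero only when [f] itself
    has a pivot. *)
Lemma reachS n r : reach n.+1 r -> reach n.+2 r.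
Proof.
move=> [f cpf rf]; exists (border f); last by rewrite last_pivotSS schur_border.
split; [by case: cpf | | by rewrite schur_border].
move=> [|i] [|j] /= il jl; rewrite ?normr0 //.
by case: cpf => _ + _; apply.
Qed.

(* The Kronecker product of f with the Hadamard matrix [[1, 1], [1, -1]]. *)
Definition double f (i j : nat) : R := (-1) ^+ (odd i && odd j) * f i./2 j./2.

(** Block elimination: with H = [[1, 1], [1, -1]], the product (f_{i,0} H) (f_{0,0} H)^{-1} (f_{0,j}
    H) equals (f_{i,0} f_{0,j} / f_{0,0}) H. Hence two scalar steps on [double f] perform one step
    on [f]. *)
Lemma schur_double f : f 0%N 0%N != 0 ->
  schur (schur (double f)) = double (schur f).
Proof.
move=> f0; apply/funext => i; apply/funext => j; rewrite /schur /double /=.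
(* This is the second pivot, - 2 f_{0,0}, by which the second of the two steps divides. *)
have f00 : - f 0%N 0%N - f 0%N 0%N != 0.
  by rewrite -opprD oppr_eq0 -mulr2n mulrn_eq0.
by case: (odd i); case: (odd j);
  rewrite /= ?expr1 ?expr0 ?mul1r ?mulN1r; field; rewrite f0.
Qed.

(** [schur_double] settles every other step. In between, the pivot is - 2 f_{0,0}, while each entry
    is, up to sign, an entry of [f] minus f_{i,0} f_{0,j} / f_{0,0}; both terms have modulus at most
    that of f_{0,0}. *)
Lemma cp_double n f : cp n f -> cp n.*2 (double f).
Proof.
elim: n f => [//|n IHn] f [f0 fle cpf]; rewrite doubleS; split => //.
- by rewrite /double /= mul1r.
- move=> i j il jl; rewrite /double /= mul1r normrM normrX normrN1 expr1n mul1r.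
  by rewrite fle //; lia.
have s00 : schur (double f) 0%N 0%N = - (f 0%N 0%N *+ 2).
  by rewrite /schur /double /= !mul1r mulfK // expr1 mulN1r -opprD mulr2n.
split.
- by rewrite s00 oppr_eq0 mulrn_eq0.
- move=> i j il jl; rewrite s00 /schur /double /= andbF expr0 !mul1r.
  rewrite normrN normrMn mulr2n.
  rewrite (le_trans (ler_normB _ _)) // lerD //.
    by rewrite normrM normrX normrN1 expr1n mul1r fle //; lia.
  (* The correction term: |f_{i,0}| |f_{0,j}| is at most |f_{0,0}|^2, by complete pivoting of [f] at
     its first step. *)
  rewrite !normrM normfV ler_pdivrMr ?normr_gt0 //.
  by rewrite ler_pM // fle //; lia.
by rewrite schur_double //; exact: IHn.
Qed.

(** The factor arises once, at the very end: peeling off pairs of steps leaves [[a, a], [a, -a]],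
    with a the last pivot of [f], and its second pivot is - 2 a. The first entry of [double f] stays
    [f 0 0], so the ratio doubles exactly. *)
Lemma last_pivot_double n f : cp n.+1 f ->
  last_pivot n.+1.*2 (double f) = - 2 * last_pivot n.+1 f.
Proof.
elim: n f => [|n IHn] f [f0 fle cpf].
  by rewrite /last_pivot /= /schur /double /=; field.
rewrite [n.+2.*2]doubleS last_pivotSS doubleS last_pivotSS schur_double //.
by rewrite -doubleS IHn // last_pivotSS.
Qed.

Lemma reach_double n r : reach n.+1 r -> reach n.+1.*2 (2 * r).
Proof.
move=> [f cpf rf]; exists (double f); first exact: cp_double.
rewrite last_pivot_double // mulNr normrN [`|2 * _|]normrM normr_nat.
by rewrite -mulrA ler_pM2l // /double /= mul1r.
Qed.

End Reach.

Delimit Scope Z_scope with ZZ.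

(** * Integer certificates for completely pivoted matrices *)

Section Certificate.
Local Open Scope Z_scope.

(** It stops at the end of the shorter list, so a column or row of wrong length would silently
    shrink the matrix; this is why [lu_check] also tests sizes. *)
Fixpoint zip_with (A B C : Type) (h : A -> B -> C) (s : seq A) (t : seq B) : seq C :=
  match s, t with
  | x :: s', y :: t' => h x y :: zip_with h s' t'
  | _, _ => [::]
  end.

(** The outer product of the column (p, c) and the row (q, u), added to [M] bordered by a zero row
    and a zero column. The pivot is p q and elimination subtracts (q a) (p x) / (p q) = a x, an
    integer: no division is ever carried out. *)
Definition extend (q p : Z) (c u : seq Z) (M : seq (seq Z)) : seq (seq Z) :=
  [seq p * x | x <- q :: u]
  :: zip_with (fun a row => q * a :: zip_with (fun x s => s + a * x) u row) c M.

Definition bounded (b : Z) (M : seq (seq Z)) : bool :=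
  all (all (fun x => Z.abs x <=? b)) M.

(* [(p, c, u) :: L'] stands for a pivot p, the rest c of its column, and the
   rest u of its row divided by p and multiplied by q.  The Schur complements computed along the
   list are scaled by q, which leaves complete pivoting and growth unchanged. *)
Fixpoint lu_check (q : Z) (L : seq (Z * seq Z * seq Z)) : bool * seq (seq Z) :=
  if L is (p, c, u) :: L' then
    let: (ok, M) := lu_check q L' in
    let M' := extend q p c u M in
    ([&& ok, 0 <? p, size c == size L', size u == size L' & bounded (p * q) M'], M')
  else (true, [::]).

End Certificate.

(** * Soundness of the certificate check over the reals *)

Section CertificateReach.
Variable R : realType.

(** Certificates live in the binary integers [Z], which compute fast, whereas [int] is built on
    unary [nat]. Passing through [int_of_Z] makes this a composite of ring morphisms. *)
Definition zr (z : Z) : R := (int_of_Z z)%:~R.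

Definition entry (M : seq (seq Z)) (i j : nat) : R := zr (nth 0%ZZ (nth [::] M i) j).

Lemma zrD x y : zr (x + y)%ZZ = zr x + zr y.
Proof. by rewrite /zr -intrD -rmorphD. Qed.

Lemma zrM x y : zr (x * y)%ZZ = zr x * zr y.
Proof. by rewrite /zr -intrM -rmorphM. Qed.

Lemma zr_ge0 x : (0 <= x)%ZZ -> 0 <= zr x.
Proof. by case: x => [|p|p] // _; rewrite /zr ler0z. Qed.

Lemma zr_gt0 x : (0 < x)%ZZ -> 0 < zr x.
Proof. by case: x => [|p|p] //= _; rewrite /zr ltr0z /=; lia. Qed.

Lemma zr_le x y : (x <= y)%ZZ -> zr x <= zr y.
Proof.
move=> xy; have -> : y = (x + (y - x))%ZZ by lia.
by rewrite zrD lerDl zr_ge0 //; lia.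
Qed.

Lemma zrN x : zr (- x)%ZZ = - zr x.
Proof. by rewrite /zr -mulrNz -rmorphN. Qed.

Lemma size_zip_with (A B C : Type) (h : A -> B -> C) s t :
  size (zip_with h s t) = minn (size s) (size t).
Proof. by elim: s t => [|x s IHs] [|y t] //=; rewrite IHs minnSS. Qed.

Lemma nth_zip_with (A B C : Type) (h : A -> B -> C) a b c s t i :
  (i < size s)%N -> (i < size t)%N ->
  nth c (zip_with h s t) i = h (nth a s i) (nth b t i).
Proof. by elim: s t i => [|x s IHs] [|y t] [|i] //=; apply: IHs. Qed.

(** The amount a x that [extend] adds to each entry of [M] is exactly what elimination with pivot p
    q removes. The length hypotheses exclude truncation by [zip_with], and positivity of [p] and [q]
    justifies the division. *)
Lemma extend_schur q p c u M n : (0 < p)%ZZ -> (0 < q)%ZZ ->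
  size c = n -> size u = n -> size M = n -> all (fun r => size r == n) M ->
  forall i j, (i < n)%N -> (j < n)%N ->
  schur (entry (extend q p c u M)) i j = entry M i j.
Proof.
move=> p0 q0 cn un Mn /allP Mr i j il jl; rewrite /schur /entry /extend.
have rn : size (nth [::] M i) = n by apply/eqP/Mr/mem_nth; rewrite Mn.
rewrite /= (nth_zip_with _ 0%ZZ [::]) ?cn ?Mn //=.
rewrite (nth_zip_with _ 0%ZZ 0%ZZ) ?un ?rn // (nth_map 0%ZZ) ?un //.
rewrite !(zrD, zrM); field.
by rewrite !gt_eqF // zr_gt0.
Qed.

(** The shape of the computed matrix goes through the induction together with [cp], since
    [extend_schur] identifies the next Schur complement only for lists of matching lengths. *)
Lemma lu_check_cp q L : (0 < q)%ZZ -> (lu_check q L).1 ->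
  let M := (lu_check q L).2 in
  [/\ size M = size L, all (fun r => size r == size L) M & cp (size L) (entry M)].
Proof.
move=> q0; elim: L => [//|[[p c] u] L IHL] /=.
case: (lu_check q L) IHL => ok M /= IHL /and5P[okL /Z.ltb_spec0 p0 /eqP cL /eqP uL bM].
have {okL IHL} [ML rL cpM] := IHL okL.
have {}bM : bounded (p * q) (extend q p c u M) by [].
have sM : size (extend q p c u M) = (size L).+1 by rewrite /= size_zip_with cL ML minnn.
have rM : all (fun r => size r == (size L).+1) (extend q p c u M).
  rewrite /= size_map uL eqxx /=; apply/(all_nthP [::]) => i.
  rewrite size_zip_with cL ML minnn => il; rewrite (nth_zip_with _ 0%ZZ [::]) ?cL ?ML //=.
  rewrite size_zip_with uL; move/(all_nthP [::]) : rL => /(_ i); rewrite ML.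
  by move=> /(_ il) /eqP ->; rewrite minnn.
split => //.
(* The pivot of the scaled matrix is p q, the very bound that [lu_check] passes to [bounded]. *)
have e00 : entry (extend q p c u M) 0 0 = zr (p * q) by [].
have pq0 : 0 < zr (p * q) by apply: zr_gt0; lia.
split; first by rewrite e00 gt_eqF.
  move=> i j il jl; rewrite e00 (ger0_norm (ltW pq0)) /entry.
  (* The Boolean test over lists becomes a bound on one entry; [sM] and [rM] ensure that [i] and [j]
     are within range, so that [nth] returns a tested entry and not its default. *)
  have /Z.leb_spec0 le_pq : (Z.abs (nth Z0 (nth [::] (extend q p c u M) i) j) <=? p * q)%ZZ.
    move: bM => /(all_nthP [::]) /(_ i); rewrite sM => /(_ il) /(all_nthP Z0).
    by apply; move/(all_nthP [::]) : rM => /(_ i); rewrite sM => /(_ il) /eqP ->.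
  by rewrite ler_norml -zrN !zr_le //; lia.
(* The remaining pivots are those of the Schur complement, which is [M] again by [extend_schur]. *)
apply: eq_cp cpM => i j il jl; exact/esym/(extend_schur _ _ cL uL ML).
Qed.

End CertificateReach.

(** * From certificates to growth, and from finitely many orders to all *)

Section CertifiedGrowth.
Variable R : realType.

Lemma zr_nat n : zr R (Z.of_nat n) = n%:R.
Proof.
elim: n => [|n IHn]; first by [].
by rewrite Nat2Z.inj_succ -Z.add_1_r zrD IHn -natr1.
Qed.

(** Removing the pivots one by one undoes [extend], until the 1 by 1 matrix of the last triple is
    left; its only entry is that triple's pivot times [q]. The form [x :: L] supplies a first
    triple, so that [last] is meaningful. *)
Lemma lu_check_last_pivot q x L : (0 < q)%ZZ -> (lu_check q (x :: L)).1 ->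
  last_pivot (size L).+1 (entry R (lu_check q (x :: L)).2) = zr R (last x L).1.1 * zr R q.
Proof.
move=> q0; elim: L x => [|y L IHL] [[p c] u].
  by move=> _; rewrite -zrM.
move=> ok; rewrite [size (y :: L)]/= last_pivotSS [last _ _]/=.
have okL : (lu_check q (y :: L)).1.
  move: ok; rewrite [lu_check q (_ :: y :: L)]/= -/(lu_check q (y :: L)).
  by case: (lu_check q (y :: L)) => ? ? /= /and5P[].
rewrite -(IHL y okL); apply: eq_last_pivot => i j il jl.
have [ML rL _] := lu_check_cp R q0 okL.
move: ok ML rL; rewrite [lu_check q (_ :: y :: L)]/= -/(lu_check q (y :: L)).
case: (lu_check q (y :: L)) => ok M /= /and5P[_ /Z.ltb_spec0 p0 /eqP cL /eqP uL _] ML rL.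
exact: (extend_schur R p0 q0 cL uL ML rL).
Qed.

(** The final comparison is growth at least (a / b) m, cross-multiplied; [q] scales first and last
    pivot alike and drops out. The target [m] is separate from the order [n], because one matrix may
    have to serve several larger orders after bordering. *)
Definition certified (n a b m : nat) (q : Z) (L : seq (Z * seq Z * seq Z)) : bool :=
  if L is x :: L' then
    [&& size L == n, (0 <? q)%ZZ, (0 <? Z.of_nat b)%ZZ, (lu_check q L).1
      & (Z.of_nat a * Z.of_nat m * x.1.1 <=? Z.of_nat b * (last x L').1.1)%ZZ]
  else false.

Lemma certified_reach n a b m q L : certified n a b m q L ->
  reach n (a%:R / b%:R * m%:R : R).
Proof.
case: L => [//|x L] /and5P[/eqP <- /Z.ltb_spec0 q0 /Z.ltb_spec0 b0 ok /Z.leb_spec0 pabm].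
have [_ _ cpM] := lu_check_cp R q0 ok.
exists (entry R (lu_check q (x :: L)).2) => //.
rewrite (lu_check_last_pivot q0 ok).
have -> : entry R (lu_check q (x :: L)).2 0 0 = zr R x.1.1 * zr R q.
  rewrite -zrM; case: x {ok pabm cpM} => [[p c] u] /=.
  by case: (lu_check q L).
(* The common factor [zr R q] of the first entry and of the last pivot is cancelled here. *)
rewrite !normrM !mulrA ler_wpM2r //.
move/(zr_le R): pabm; rewrite !zrM !zr_nat => pabm.
have b1 : (0 : R) < b%:R by rewrite ltr0n; lia.
have x0 : 0 <= zr R x.1.1.
  move: ok; case: x {pabm cpM} => [[p c] u] /=.
  by case: (lu_check q L) => ok M /= /and5P[_ /Z.ltb_spec0 p0 _ _ _]; rewrite zr_ge0 //; lia.
rewrite (ger0_norm x0) (le_trans _ (ler_norm _)) //.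
rewrite -(ler_pM2l b1); apply: le_trans pabm.
(* After multiplication by b the two left-hand sides are equal; [pabm] is the integer comparison
   made by [certified]. *)
by rewrite le_eqVlt; apply/orP; left; apply/eqP; field; rewrite gt_eqF.
Qed.

Lemma reach_widen n k r : (0 < n <= k)%N -> reach n r -> @reach R k r.
Proof.
move=> /andP[n0 /subnK <-]; elim: (k - n)%N => [//|d IHd] rn.
by rewrite addSn; case: (d + n)%N (ltn_addl d n0) (IHd rn) => // ? _ /reachS.
Qed.

(* The shift by one in [n.+1] absorbs the passage from an even to an odd order. *)
Lemma reach_linear (c : R) (N : nat) : (0 < N)%N -> 0 <= c ->
  (forall n, (N <= n < N.*2)%N -> @reach R n (c * n.+1%:R)) ->
  forall n, (N <= n)%N -> @reach R n (c * n.+1%:R).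
Proof.
move=> N0 c0 base; elim/ltn_ind => n IHn Nn.
have [n2|n2] := ltnP n N.*2; first by apply: base; rewrite Nn.
(* As n is at least 2 N, its half is at least N and smaller than n, so the induction hypothesis
   applies. *)
have : reach n./2 (c * n./2.+1%:R) by apply: IHn; lia.
case h2 : n./2 => [|m] rm; first by lia.
have : reach n (2 * (c * m.+2%:R)).
  by apply: (reach_widen _ (reach_double rm)); lia.
(* Here n./2 = m.+1. For odd n the number n.+1 equals 2 * m.+2 exactly, so the single bordering uses
   up all the slack; for even n one unit is left. *)
by apply: reach_le; rewrite mulrCA ler_wpM2l // -natrM ler_nat; lia.
Qed.

(** Pure doubling preserves the ratio of growth to order. These orders are sparse, but a limsup only
    needs infinitely many of them. *)
Lemma reach_geometric (c : R) (m k : nat) : (0 < m)%N -> reach m (c * m%:R) ->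
  reach (m * 2 ^ k) (c * (m * 2 ^ k)%:R).
Proof.
move=> m0 rm; elim: k => [|k IHk]; first by rewrite muln1.
rewrite expnS mulnCA mul2n.
have : (0 < m * 2 ^ k)%N by rewrite muln_gt0 m0 expn_gt0.
case: (m * 2 ^ k)%N IHk => // p /reach_double rp _.
by move: rp; rewrite mulrCA -natrM mul2n.
Qed.

Lemma reach_limn_esup (c : R) m : (0 < m)%N -> 0 <= c -> reach m (c * m%:R) ->
  (c%:E <= limn_esup (fun n : nat => gCP R n * ((n%:R : R)^-1)%:E))%E.
Proof.
(* The limsup is the infimum, over neighbourhoods V of infinity, of the supremum over V. For each V,
   containing all n from some N on, it suffices to find one good order in V. *)
move=> m0 c0 rm; apply/ereal_infP => _ [V [N _ NV] <-].
(* The threshold itself serves as exponent, since N < 2 ^ N. *)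
have := reach_geometric N m0 rm.
have : (N <= m * 2 ^ N)%N.
  by rewrite (leq_trans (ltnW (ltn_expl N (ltnSn 1)))) // leq_pmull.
have : (0 < m * 2 ^ N)%N by rewrite muln_gt0 m0 expn_gt0.
move: (m * 2 ^ N)%N => n n0 Nn rn.
apply: (le_trans _ (ereal_sup_ubound _)); last by exists n => //; exact: NV.
have : ((c * n%:R)%:E <= gCP R n)%E by apply: reach_gCP => //; rewrite mulr_ge0.
move=> /(lee_wpmul2r (_ : 0 <= ((n%:R : R)^-1)%:E)%E).
rewrite lee_fin invr_ge0 ler0n => /(_ isT); apply: le_trans.
by rewrite -EFinM mulfK // pnatr_eq0 -lt0n.
Qed.

(** Bordering up to order [k] loses nothing, and the target [m] pays for k + 1 as long as k < m.
    This provides the shifted bound that [reach_linear] wants on a whole interval of orders. *)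
Lemma certified_reach_range n a b m q L : certified n a b m q L ->
  forall k, (0 < n <= k)%N -> (k < m)%N -> reach k (a%:R / b%:R * k.+1%:R : R).
Proof.
move=> /certified_reach rn k nk km; apply: (reach_widen nk); apply: reach_le rn.
by rewrite ler_wpM2l ?divr_ge0 // ler_nat.
Qed.

End CertifiedGrowth.

(** * Integer LU factors of matrices with large growth *)

Section Data.
Local Open Scope Z_scope.

(** In each triple complete pivoting forces |c_i| <= p and |u_j| <= q; here many entries stop just
    short of these bounds. In this list and in all the others, the last four pivots are nearly in
    the ratios 1 : 2 : 2 : 4, the pivots of a Hadamard matrix of order 4. Growth is 271560 / 24576,
    about 11.0498, against a target of 11.0495. *)
Definition lu11 : seq (Z * seq Z * seq Z) :=
  [:: (24576, [:: 24573; 24574; 9564; -24568; 24568; 24565; 24570; -24565; -24574; 24574], [:: -21843; -21838; -21836;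
  21843; 21842; 21836; -7101; 21838; 21836; -6392]);
  (49144, [:: 28226; -9863; -49139; 29710; 49119; 22463; -49128; 2; -2], [:: -4; 21842; -10588; 2; -21841; 14474; 4;
  -21698; 14116]);
  (49144, [:: 20853; 5; 49139; 42547; 49139; 8; 8; -8], [:: -7266; 3864; -21843; 8065; -13990; 1; -9379; -15835]);
  (49152, [:: 44799; -13376; -34978; 43019; 2145; -49137; -10], [:: -18936; -5904; -1132; 21143; 6672; 6298; 20788]);
  (64154, [:: -55026; -40340; 39491; -21965; 6545; -11878], [:: 19770; 303; -14764; 4052; -21022; 2217]);
  (69613, [:: 69606; 25026; 69606; -6463; -38400], [:: -11767; -9115; -4550; 16; 20867]);
  (69663, [:: -29653; -11233; -6129; -69656], [:: 19723; -5167; -3405; 549]);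
  (71414, [:: 71407; 71407; 71407], [:: -21843; 19695; -19695]);
  (135800, [:: 131537; -7], [:: -21843; -265]);
  (135800, [:: -135787], [:: 21843]);
  (271560, [::], [::])].

Lemma lu11_certified : certified 11 10045 10000 11 21845 lu11.
Proof. by vm_cast_no_check (erefl true). Qed.

Definition lu12 : seq (Z * seq Z * seq Z) :=
  [:: (1450, [:: 1447; -1066; 524; 709; -1218; -1419; -1411; 1411; 1447; 1447; 1305], [:: -1192; -863; -748; 429; 1185;
  -1171; 1192; 1127; -673; 1192; -1162]);
  (2861, [:: -2510; 283; 2155; -1523; -2784; -2535; -38; -3; 2712; -145], [:: 1041; -222; -821; -1172; 1087; -86; -15;
  -263; 1; 1165]);
  (2864, [:: 1580; -1560; 1893; -47; -259; -375; 2366; -2764; -377], [:: -1068; -214; -687; -86; 971; -198; 123; 1048;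
  1192]);
  (3242, [:: -1998; 2048; -1889; -141; -905; 1600; 386; 1900], [:: 640; 240; 608; -1192; 448; 463; -170; -25]);
  (3464, [:: -2814; -1518; -2654; -1200; -2401; -806; -207], [:: 814; 231; -104; 447; 1122; -370; 534]);
  (3758, [:: 1509; -398; -2075; 2685; 1554; -3316], [:: -514; 746; 1009; -258; -785; 369]);
  (4400, [:: 2766; -254; 3835; -2068; 478], [:: -856; -40; -100; 856; 815]);
  (4743, [:: -2447; 536; 308; 4734], [:: 1052; 709; 0; -169]);
  (4743, [:: -4734; -4733; -4734], [:: 1192; -1060; 1062]);
  (8962, [:: 8454; -9], [:: -1190; -60]);
  (8962, [:: -8944], [:: 1192]);
  (17870, [::], [::])].

Lemma lu12_certified : certified 12 10045 10000 12 1194 lu12.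
Proof. by vm_cast_no_check (erefl true). Qed.

Definition lu13 : seq (Z * seq Z * seq Z) :=
  [:: (490, [:: -488; -482; -437; -175; -488; 223; 482; -482; -488; -465; 482; 482], [:: 424; -259; -11; -15; 308; 237;
  73; 419; -424; -419; -424; 314]);
  (972, [:: 967; -31; 662; 658; -710; -967; -3; -2; 948; 3; -697], [:: -344; -219; -221; 40; 106; 230; 421; -411; -424;
  1; 369]);
  (975, [:: -778; 814; 721; 51; 1; -755; -615; 970; -192; 219], [:: 354; 36; 181; 225; -394; -424; -15; 0; 2; -424]);
  (1107, [:: -761; -761; -889; -157; 1101; 9; 158; -315; -40], [:: 198; 62; 424; -415; -309; -2; -365; -36; 24]);
  (1110, [:: 1104; -439; 12; -549; -458; -168; -306; -832], [:: -253; -87; -244; 101; 375; -251; -281; -30]);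
  (1237, [:: -734; -714; -305; 828; -777; -890; -376], [:: 412; -70; 76; -424; 228; 228; 384]);
  (1682, [:: 1311; -734; 180; 558; 1432; -464], [:: -338; -92; -328; -210; -60; 423]);
  (1704, [:: -973; 29; 1323; -242; -936], [:: 316; -163; -18; 383; -163]);
  (1759, [:: 343; 404; 313; 1750], [:: -424; 95; -72; -85]);
  (1696, [:: 1687; 1666; 1687], [:: -417; -406; -406]);
  (3312, [:: 3247; -35], [:: -9; 424]);
  (3347, [:: 3295], [:: -424]);
  (6609, [::], [::])].

Lemma lu13_certified : certified 13 10045 10000 13 426 lu13.
Proof. by vm_cast_no_check (erefl true). Qed.

Definition lu14 : seq (Z * seq Z * seq Z) :=
  [:: (682, [:: 680; 533; -86; 655; 219; -595; -680; -117; -677; 677; -190; -500; -677], [:: -932; -935; -416; 453;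
  -645; 500; 792; -928; 930; -930; 926; 337; -842]);
  (1355, [:: -150; 379; 1145; -335; 89; -333; 564; -1351; 1351; 491; 183; 7], [:: 935; -240; -471; 794; -376; 73; 935;
  -639; -4; -934; 301; -48]);
  (1361, [:: -1065; 95; 1020; -1357; -1019; -923; 1352; -29; 1; -1357; -2], [:: 571; -667; 242; 231; -771; 935; -660;
  828; 3; 358; -70]);
  (1387, [:: 1203; -614; -95; -446; 1334; -789; 72; -639; 1331; 383], [:: -815; 389; 771; -935; -54; -678; 120; -145;
  -246; -445]);
  (1636, [:: 596; -35; -1631; 1523; -756; -287; 463; -106; 157], [:: -731; -128; 754; 92; 935; 629; 0; -576; 313]);
  (1571, [:: 558; -328; 994; -395; -244; -601; -1463; 172], [:: -333; 159; -740; -864; -194; 19; -499; -546]);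
  (1638, [:: 1188; -700; -788; -677; 1353; -1633; 812], [:: -836; 248; 490; 824; 245; 935; -551]);
  (2424, [:: -2070; 293; -1641; -259; 178; 2200], [:: 355; 249; 176; 251; -935; -211]);
  (2602, [:: -1536; -688; -1834; -705; -2260], [:: 651; 14; 823; 0; -359]);
  (2602, [:: 2289; -998; 0; 2193], [:: -71; 0; 0; -935]);
  (2602, [:: -2410; 2394; -2394], [:: 935; -935; 935]);
  (4996, [:: 208; 4981], [:: -935; -36]);
  (5188, [:: 5173], [:: -899]);
  (10131, [::], [::])].

Lemma lu14_certified : certified 14 10045 10000 14 938 lu14.
Proof. by vm_cast_no_check (erefl true). Qed.

Definition lu15 : seq (Z * seq Z * seq Z) :=
  [:: (3413, [:: -3410; -3403; -2416; 3398; -2248; -2298; 3410; -3409; 3403; -3403; 3408; 3408; 1651; 3408], [:: 3069;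
  3069; 2376; -3043; 3063; -510; 3059; -3059; 3059; -2709; -3063; -3063; -1510; 2866]);
  (6816, [:: -10; 5038; -6804; 2071; 1772; -6717; 4522; -3289; 6809; 0; 5; -3524; 5], [:: 1686; 233; 15; 2847; -637;
  3067; -3062; 2748; -2887; -852; -1; 627; -99]);
  (6815, [:: -3276; 249; -630; 4679; 1661; -307; -5004; -677; 5; -6808; 3695; 2], [:: 2724; -2087; 794; -1793; 2672;
  -220; -5; -2894; -3068; 8; -2290; -106]);
  (7702, [:: 1077; 5269; 367; -643; 5975; -1355; -695; 770; 874; -7695; 729], [:: -1771; -1912; -329; -153; 2310; 520;
  -1168; -3068; 403; -498; 2279]);
  (7598, [:: -1984; 4516; 758; -3571; -2152; -7590; 413; -621; -1831; 7207], [:: 1443; -1308; -34; -316; -231; 153;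
  -236; -67; 2761; -3069]);
  (8101, [:: 190; 5050; 8093; -2294; -3019; -6524; 2602; 146; -2925], [:: -400; 538; -2956; -1542; 1852; -226; 165;
  1536; -128]);
  (8112, [:: 4465; -3045; -7806; 162; -2986; 172; -3293; -76], [:: -2623; -1222; 1702; 2746; 72; 434; -2085; 1212]);
  (8180, [:: -8022; 1304; 1139; -8172; -1158; -7989; 572], [:: 2788; 2114; -2283; 2361; 2254; 2785; -2654]);
  (13498, [:: -9355; 2628; -600; 9223; 13485; 3637], [:: 2902; -297; 3069; -407; -205; -3069]);
  (14134, [:: -11438; -258; -13718; 748; -11643], [:: 1440; 199; 1299; -1965; -2879]);
  (14418, [:: 465; -1713; 68; 14404], [:: -2100; -508; 0; -3069]);
  (14418, [:: -14404; -14122; 14404], [:: 2896; 2829; -2829]);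
  (27698, [:: 27126; 826], [:: -126; -3069]);
  (28524, [:: -27636], [:: 3069]);
  (56104, [::], [::])].

Lemma lu15_certified : certified 15 10045 10000 15 3072 lu15.
Proof. by vm_cast_no_check (erefl true). Qed.

(** From this order up to 28 the target exceeds the order: growth 111501 / 6144, about 18.15, must
    cover 1.0045 * 18, so that the matrix also serves order 17 with the shifted bound. *)
Definition lu16 : seq (Z * seq Z * seq Z) :=
  [:: (6144, [:: -6140; -6123; -4943; 4393; -1530; 6131; -4877; -6130; 6130; -3916; -6130; 6130; -6130; -6130; 6130],
  [:: 5116; -1370; 4323; 4426; 1809; -5110; 2974; -1274; 5110; -5110; 5110; -5110; -5108; -3948; 3938]);
  (12267, [:: 12258; 1612; -8816; 4330; 13; -826; -14; -12258; -2039; 12258; -442; 12258; 12258; 14], [:: -3248; -399;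
  2521; -1656; -4536; 1672; 1619; 3105; 5; -5; 5; -5115; -4535; 4398]);
  (12278, [:: -6439; -991; 6962; -2127; 3901; 3998; 3; 3799; 12270; 7173; 12270; -3; 3593], [:: 3445; 2251; 207; 3215;
  1855; 309; 1978; -1390; 3567; 7; -1; 5116; -4987]);
  (14771, [:: -9868; -9195; -6023; -4712; -3577; 8; 6731; -8265; -14761; 4014; 12080; -1885], [:: 4315; 3004; 1082;
  3749; -2596; 4120; -189; 5116; 420; 977; -724; -89]);
  (15436, [:: 7059; 736; 1137; 424; -5412; 3186; -5303; 10346; -4946; -15425; -11431], [:: -1530; -2001; 2347; 1684;
  5116; 2061; 6; -310; 1193; 436; 3051]);
  (15304, [:: 6199; 6960; 10366; -1869; -8566; 2762; 15293; 7942; 573; -10755], [:: -629; -1109; -5116; 902; -2149; -93;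
  1934; -1080; -21; 2011]);
  (15928, [:: -11894; -10337; -951; -15232; 3190; 4124; 1370; -9908; -7656], [:: 2214; -512; 1239; 4425; -1493; -585;
  732; 925; -5116]);
  (17408, [:: 17396; -3217; -6231; -3326; -4561; 1708; -3945; 8876], [:: -1272; 4208; 771; 123; -666; 1250; -3858;
  -3899]);
  (16070, [:: 10562; -15963; -11429; 11046; 12158; 10540; -11342], [:: -4054; 3654; 3123; -4708; -3909; 3785; 4235]);
  (24423, [:: -13386; 4459; -4418; -3989; 24406; -13244], [:: 1558; -3972; 4577; -507; -4587; 793]);
  (28204, [:: 10874; 6501; -12370; 1109; 28184], [:: -3033; -2258; -4671; -2950; -142]);
  (29921, [:: 5038; -29900; -1680; -2166], [:: -3891; 3022; 453; 4095]);
  (28992, [:: -28972; -28972; 28253], [:: 4755; -4395; -4869]);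
  (55879, [:: 55435; 2732], [:: -4775; 130]);
  (55809, [:: 55770], [:: -5116]);
  (111501, [::], [::])].

Lemma lu16_certified : certified 16 10045 10000 18 5120 lu16.
Proof. by vm_cast_no_check (erefl true). Qed.

Definition lu18 : seq (Z * seq Z * seq Z) :=
  [:: (1536, [:: -1533; -803; -1075; 1533; 1307; 1139; 1527; -1527; -1525; 1435; 1527; -48; 1506; 557; 1525; 541;
  -1533], [:: 1618; -1611; 1019; -833; -682; -403; -1496; -1618; 1612; -1618; 1608; 1618; 886; -1612; 1606; 1611; 581]);
  (3063, [:: 2334; 404; -927; -2332; 132; -274; 3049; 3048; -2510; 2; -1480; -3028; 977; -3048; 748; -3], [:: -1618;
  -79; -945; 124; -278; -454; -1618; 770; 2; 1614; 57; -368; -105; 1615; 1618; 1102]);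
  (3064, [:: -2199; -727; -2479; 2797; 2777; -8; 2652; -2612; -14; 8; -2938; 3058; 8; -249; 6], [:: 1118; 1125; 537;
  -327; -284; 533; -499; 386; 2; -348; 1125; -1153; -1618; 1; -1498]);
  (3746, [:: -1860; 1680; -3594; -3681; 2646; -7; -755; 582; 1486; 2466; -880; 421; -1665; 1208], [:: 1177; -479; 350;
  116; -640; 744; 72; -375; -410; 1618; -1618; 1; -375; -1119]);
  (3636, [:: 1053; 2276; -162; 609; 595; 124; -1161; -3505; 790; 905; 229; 3629; -138], [:: -251; -471; 1201; -224; 220;
  980; 226; -318; -98; -1089; 74; -1142; -1520]);
  (3744, [:: -1818; -2669; -816; -132; 2991; -893; 1520; 3736; 559; -500; -1211; 993], [:: 302; -520; 924; -1337; -151;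
  -113; -1150; -1156; 102; 17; 1599; -243]);
  (3833, [:: 3671; -1527; -655; -2492; 1614; -353; -925; 2805; -1606; 3384; 666], [:: -832; 514; -856; -1035; -426;
  -1618; 603; -146; 1260; -98; 1269]);
  (4763, [:: -3011; -2441; -1725; 1234; 807; 1522; 3868; -2162; -2090; -2099], [:: 256; 834; 1618; -963; 484; -305;
  -457; 84; 741; -758]);
  (4785, [:: 2927; -2671; 2935; -3841; -13; -3048; -1722; -373; 10], [:: -913; 500; -1618; 858; -1079; -252; -590; 24;
  699]);
  (4790, [:: 1358; 1034; -2497; -1934; -26; -72; -576; 4781], [:: 40; -627; 543; 981; 748; 1466; -501; -665]);
  (4747, [:: 2521; 3896; 1441; -3290; 4517; 4273; 1154], [:: -1453; -852; 624; -1618; -1117; -818; 1095]);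
  (6997, [:: 2905; 4971; -6321; 618; -906; 5246], [:: -720; -847; 1364; -567; -411; -1404]);
  (8015, [:: 5175; 201; -524; 6581; 6105], [:: -648; -90; 1618; -412; -276]);
  (8216, [:: -6693; -6363; 1556; 0], [:: 450; 0; 49; 1618]);
  (8216, [:: 8200; 7678; -7661], [:: -1618; -1528; 1618]);
  (15894, [:: -537; -15846], [:: 1523; 2]);
  (15894, [:: 15862], [:: -1618]);
  (31692, [::], [::])].

Lemma lu18_certified : certified 18 10045 10000 20 1621 lu18.
Proof. by vm_cast_no_check (erefl true). Qed.

Definition lu20 : seq (Z * seq Z * seq Z) :=
  [:: (4778, [:: -4539; -4775; 1871; -1786; 3586; -4775; -4532; -4262; -1993; -1851; -3881; 465; -4334; 4532; 4367;
  4532; 4532; -4367; 4357], [:: 5798; 4354; -4489; -5503; -4911; 5167; 5798; -479; 1414; -2906; -4742; -5798; 2424;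
  -5798; -5798; -5798; -507; -5393; 5798]);
  (9310, [:: 6858; 2905; 6559; 119; 6558; 589; 7900; 6766; -2925; 8525; -5240; 8985; 56; -2170; -151; -2180; 3493;
  -9005], [:: -853; -5164; -3873; -1677; 2850; 5758; 1688; 3638; 1559; -5248; 149; 4157; 50; -3167; 149; 2076; -5556;
  5426]);
  (9366, [:: -4442; 7034; 1978; 9322; 6269; 9134; 32; -305; 8941; 3655; 9348; 1382; -8371; 372; 1053; 8162; 181], [::
  3366; -2928; -4233; -2411; -1329; -4438; -4529; 112; 3175; -107; -4390; -5798; -3145; -107; 1179; 3203; 1377]);
  (11385, [:: -412; 6508; -3907; -4285; -4839; 6559; -7855; 4172; -11199; 1485; -2020; 1530; -1618; 5730; -9781; 25],
  [:: 1812; -2362; -1193; -909; 350; -5361; -2090; 924; 2922; -5605; 1111; -954; -1560; 2447; 1120; -4060]);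
  (11090, [:: -2328; 6807; 1817; 6640; -3009; 2552; 442; -2488; 10913; 890; 2767; 9666; 6360; 10137; 2798], [:: 5297;
  -1867; 835; -746; 3247; 754; 2859; -3343; -1991; 2178; 4569; 425; 471; -2070; -5798]);
  (12408, [:: -7450; -3702; -7465; 935; -12399; 2223; -5517; -1676; 8001; -9716; -10194; 5276; -5194; -6102], [:: 1372;
  -712; 1991; 1467; 4278; 2138; 1764; 293; 450; 5798; 357; -3489; -2107; 1146]);
  (12827, [:: 11705; 1842; -533; 1673; 8233; 6653; 2769; -10285; 1975; -3394; 4225; 12818; -1807], [:: -3113; 1683;
  -2707; -2672; -3543; 1367; 3646; -576; 3085; -490; -5798; -3438; -1270]);
  (14034, [:: -5271; -4800; -2316; 7522; 2293; -7277; -14024; -9194; -4238; -4002; 10790; 7281], [:: 2117; 4888; 3541;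
  -1272; 794; 126; -602; -287; -3833; 5798; 1957; -72]);
  (14207, [:: -6079; 1106; 2538; 8615; 12693; 2231; -3806; 12846; -4065; -3889; -1337], [:: 2730; 2983; -2406; -101;
  -1963; 3359; 3453; -3696; -2332; 2776; 1854]);
  (15206, [:: -6068; 1463; 359; 4632; -3158; 11316; -13879; 3965; -12368; 3153], [:: 3752; 2076; -777; 1688; 2109; 1191;
  -4618; -2868; 3356; -2272]);
  (16158, [:: -12425; 3680; -12992; -4570; 6672; 16147; 8872; 744; -2660], [:: 3049; 636; 885; 2027; 3532; -4885; 1006;
  -2316; 2349]);
  (16455, [:: 9535; 9776; -9741; 2873; 6198; -15674; 10992; -8385], [:: -4441; 2861; 4428; 3618; -78; 1311; -44; 883]);
  (16538, [:: 16526; 5427; 16526; 15538; -13954; 14931; 6520], [:: -5798; -118; -5742; 4922; 4414; -4113; -5090]);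
  (27525, [:: 21200; 0; 26154; -532; -1606; 21454], [:: -3413; 426; -5710; 351; -88; 5756]);
  (29107, [:: -16190; -240; 15662; 6859; 29086], [:: 3552; -53; 2216; 2702; -5798]);
  (30050, [:: -1110; -30029; -5248; 3596], [:: 388; 1535; 5798; 2187]);
  (29158, [:: 29134; -28672; 29111], [:: -5711; 5795; -5704]);
  (57815, [:: -56862; -484], [:: 4; 5798]);
  (57814, [:: -57774], [:: 5798]);
  (115507, [::], [::])].

Lemma lu20_certified : certified 20 10045 10000 24 5802 lu20.
Proof. by vm_cast_no_check (erefl true). Qed.

(** Growth 95714 / 3120 is about 30.7, against a target of about 28.1: the margin widens with the
    order, so ever fewer matrices are needed. *)
Definition lu24 : seq (Z * seq Z * seq Z) :=
  [:: (3120, [:: -3116; 3089; -2876; 1284; -2750; 195; 2834; -1132; -3104; 393; -3114; 1908; -15; 3101; 3090; 1888;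
  3106; 3113; 3114; -3104; -1737; 3112; 3111], [:: 3069; 1817; 1934; -2266; 2206; -2723; 442; -2931; -2333; -2191; 2689;
  -740; -3060; -1388; 3045; -1820; -3063; -3060; -2239; 3055; -3047; 3057; -3061]);
  (6227, [:: -6202; 1367; -4392; 1721; 2525; -5945; 4236; 5292; -3246; -4; -5021; 2764; -6207; -5047; 1222; -6198;
  -5725; 2; -15; -1372; -658; -6196], [:: 2446; 220; 403; 2639; -2696; 845; -3003; -842; -2623; 2781; -1907; -64; 453;
  3057; 552; 4; -1854; -996; 3063; -671; -7; -1974]);
  (6228, [:: 2900; 1828; -1616; -768; 4218; -5215; -3079; 5467; -1272; 4053; -5309; 6219; 3221; -2370; -16; -397; -2438;
  -844; -751; 1150; 17], [:: -2259; 695; 2282; 203; 267; -90; 1855; -2396; 2972; -3036; 2823; 622; 3068; 2509; -13;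
  -1865; 1656; -1; -693; -2380; -433]);
  (6960, [:: 3964; -283; 2247; 2828; -6541; 2402; 5979; -286; -976; -1006; 18; -2330; -6128; 1593; -4610; -4824; -1779;
  3755; 2048; 1609], [:: -2671; -1484; -1482; 644; 266; -1019; -561; -2046; -39; -3033; 453; 755; -3068; 89; 1252; -46;
  -714; -2210; 1318; -2072]);
  (7672, [:: -3780; 1701; 7063; -3987; -3315; 1563; -5372; -2811; -3159; -1192; 3303; -6675; 1378; -3983; 1769; -528;
  5449; 2120; 7605], [:: 2612; -581; -1231; -764; 1240; 807; 1753; 1023; 2617; 1354; -752; 361; 1249; -1783; -1814; 364;
  185; 134; -692]);
  (7888, [:: -5215; -7816; -1265; 1008; -2203; 7808; 4966; 664; 1065; -7324; 5186; -408; 5824; -6183; -658; 3030; -6453;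
  500], [:: 562; 671; 425; 1521; -1529; 980; -807; 764; 1421; 1452; -1392; 743; -3067; 11; -184; 165; 1904; 82]);
  (7913, [:: 2594; -3490; -673; 3837; -7592; -5697; 4674; -6635; 2054; 851; -4697; -3164; -1041; -6604; 2708; 1559;
  -2895], [:: -795; 2449; 1966; 834; 1394; 801; 91; -742; 1361; -1220; 1478; -364; -262; 160; -289; -661; 2662]);
  (8569, [:: 1712; -6082; 1896; -2127; -1023; 708; -3509; 7723; 228; 3467; -4675; -545; -3996; -988; -1247; 6222], [::
  -855; 498; -2520; 396; -2510; -2025; 1839; -230; -1552; -923; 9; -283; 1949; 2814; 431; -738]);
  (9032, [:: -3321; -7968; 3174; 3102; 1328; 4044; -2002; -2443; -1239; -5928; 8408; -1845; -1727; 5127; -478], [::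
  2603; 1167; -418; 1204; 1820; -597; 2766; -2533; 13; -2102; -726; -685; -1548; -1104; -1393]);
  (9933, [:: 5654; 2237; -5943; -1287; -4869; -3447; 5897; 1223; 4081; 1330; 7649; -6920; 2480; 2236], [:: -1229; 821;
  160; -107; 1556; 1531; 2; -2067; -2819; -1648; -353; 1919; -1360; 449]);
  (10276, [:: 5152; -2699; -5639; 1121; -2486; 10115; 4831; -2080; -3812; -4234; -2779; -6358; -664], [:: -1973; 2676;
  2435; -750; 970; 49; 1739; -1413; 621; 1347; -370; 1759; -2064]);
  (11041, [:: 4435; 1369; 1043; -8343; -1336; 10719; -4119; -623; 4006; -2473; -8739; -4250], [:: -1918; -1141; 263;
  -107; 1290; -1203; 2706; -2181; 2143; -1317; -392; 2461]);
  (11554, [:: 5470; 4036; -1682; -9771; 187; -5159; -6583; 269; -5696; -7496; 1489], [:: -960; -382; 789; 374; 1781;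
  -334; -1747; -148; 2999; 275; -982]);
  (11925, [:: -9022; -1613; -10476; 10001; 3029; -7036; -2723; -6319; 2596; -1205], [:: 1497; -911; 2259; 483; -2155;
  2650; 461; -2180; -790; -2508]);
  (13034, [:: 4793; 2563; -10104; 1727; 10575; -6996; -1579; -2234; -9274], [:: -2260; 4; 722; -1981; 1732; 2280; -437;
  -1612; 967]);
  (13864, [:: -9467; 3533; 11892; 7757; -2634; 8874; -7510; 835], [:: 1149; 881; -422; -2531; -1077; -2292; 1690; 907]);
  (14227, [:: -13301; -14209; 8751; -8577; 9695; 12815; 10794], [:: 2901; 750; -2200; -3069; -3069; -1396; -2381]);
  (23547, [:: 21039; 44; 22312; -16691; 2078; -2487], [:: -951; 221; -2292; 120; -2643; 325]);
  (24190, [:: 7314; -5213; -20160; 1035; 1590], [:: -1999; 1934; -103; -26; -3066]);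
  (24361, [:: 540; -896; -4464; 23155], [:: -453; 2925; 1722; -13]);
  (24365, [:: 23617; 22855; 24079], [:: -3069; 2968; -3058]);
  (47933, [:: 46935; -284], [:: -2990; -53]);
  (47930, [:: -47882], [:: 3069]);
  (95714, [::], [::])].

Lemma lu24_certified : certified 24 10045 10000 28 3072 lu24.
Proof. by vm_cast_no_check (erefl true). Qed.

Definition lu28 : seq (Z * seq Z * seq Z) :=
  [:: (4254, [:: 4249; 4243; 1790; 2927; 2776; 250; -4246; 3558; 3813; 4243; 159; -4170; 937; 2568; 1289; 4117; -4245;
  406; 2016; -3270; 4248; 1228; -4238; -4230; 2212; 1719; -4239], [:: -5455; 1386; -2601; -5455; -2940; 1480; 2318;
  -1690; 4790; 1197; -5448; -2401; -4992; 1153; -5436; -5441; -4362; -5405; -2502; -2404; -5443; 5442; -4181; 5373;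
  5403; -415; -5360]);
  (8493, [:: 8485; -2457; 6922; -1062; 1160; -7855; 6911; 2982; 5906; -4085; -8412; 4407; 6813; 4106; -134; -4388;
  -3844; 540; -3661; -5; 5474; 9; -8473; 896; -2525; -8473], [:: -3426; -1315; 485; -1261; -3461; -1521; 3344; -1348;
  -1962; 5371; 3931; -229; -3304; 11; 5447; 2093; 5406; 3982; -1529; -8; -5445; -629; 35; -5421; 2896; 5206]);
  (8497, [:: -5897; 6383; -5618; -2239; -3120; 6041; 5151; -1618; -459; 28; 6777; 6013; -1995; -2367; 1784; 692; 4076;
  -5716; 1291; 7119; -2206; -8487; -4238; -6253; 9], [:: 4895; 628; 4167; 1767; 2847; -3419; -2971; 1805; 85; 3; 3440;
  5453; -26; -1001; 2819; -3180; -289; 713; 3282; -10; 5446; 13; 5438; -5415; -5251]);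
  (9794, [:: -6757; 3189; 6627; -3288; 2168; 1125; 1112; 3746; -368; -8815; -6279; -857; 7582; -430; -4957; 1681; 6932;
  -3384; -229; -4187; -698; 9316; 8211; -4030], [:: 3864; 361; -1168; 2934; -3277; -1788; 1510; 26; 1104; 5295; 3785;
  -467; -298; 5388; -732; 3651; -1884; 4127; -4; 1516; -2746; -1374; -89; -3244]);
  (10606, [:: 2706; -6930; -5092; 4422; -1039; 823; -6318; -3994; 1919; 9957; 4664; 3281; 320; -71; 4556; -10528; 2275;
  -4162; 1654; 2244; -8224; 1098; -3251], [:: -2466; 2230; 2692; -3213; 2393; 1340; -1476; -3383; 3537; 1548; -977;
  -3827; 3755; 1598; -1053; -1532; -26; -123; 1440; -5450; 86; 3613; 1363]);
  (10796, [:: -4481; -1405; -3493; 2412; 9429; -6325; -1739; 1066; 7528; 8690; 726; -8734; 2393; 4292; 791; -1696;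
  -2367; -3710; -946; -2160; 9310; -2449], [:: 2134; 262; 2905; -4110; -1755; 1885; -282; -1539; -1108; 3909; 4608;
  2410; 2232; -864; -370; -256; 241; 1436; -1341; 2811; -5454; -2371]);
  (11639, [:: -4115; 4606; -5338; 1603; -634; -5775; 1505; -10922; -6831; -3184; -3266; -487; -452; 1642; -5779; 7656;
  5996; 1946; 11627; 1836; 1445], [:: 2676; -1336; 2313; -2213; 358; -5080; -2703; 1687; -693; 1039; -1470; 1333; -5394;
  -1619; 279; -1547; -239; -4301; 1393; -3212; -1658]);
  (11799, [:: -3922; -3316; -4505; -3500; 248; 4057; -3117; -1517; -8964; -2505; -3031; -2703; 8220; 5381; -8420; -2624;
  -2018; -9274; -339; 6861], [:: -103; 2856; 1587; -547; -1255; -1128; -130; -1633; -1376; 1502; 65; 2219; -5456; 2076;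
  -4198; 2615; -4783; 2214; 334; -2126]);
  (11714, [:: 3722; -4276; 8187; 4217; 1798; -10; -11701; 773; 6681; -5796; 8340; 1; 5272; -2375; 3403; 4656; 4731;
  3473; -2912], [:: -2341; 1935; -2020; 1740; -4192; -5456; 4948; -1006; -330; 1768; -1092; -567; 1701; 2868; 1386;
  2576; -1974; 1575; -1394]);
  (12396, [:: 4264; 7693; 10290; -5207; 3951; 5935; 2075; -1935; -5660; 11796; 3055; -264; 8505; 2172; 1551; -1292; 322;
  -1320], [:: -1520; -1087; -5455; 1047; -1366; -3213; -1901; 761; 3381; -1416; 812; 1998; -4939; -2813; -3768; -46;
  -157; 712]);
  (13154, [:: 1377; -6301; -3058; 3437; 7032; 1598; -11752; -2630; 3377; -2912; -11624; 4176; -436; 4423; 9605; -3315;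
  2513], [:: -1675; 3371; -482; -1184; -544; -2397; 497; -5138; -882; 1715; 818; 43; 5102; -1029; -2346; 4692; -2339]);
  (13565, [:: 9949; -4566; -6117; -7924; 1127; -2647; -5240; 3140; -6542; 446; 419; -5802; 12489; -1630; 5768; -137],
  [:: -1362; 2851; 4276; -1709; 5450; 3901; -523; -521; -4260; -1082; -28; 2854; -1822; 4021; 166; 3283]);
  (14710, [:: 1632; -2276; 2007; 2790; 4295; -4861; 6677; 4199; 9332; 10156; 450; 11765; -2962; 10655; 8103], [:: -1778;
  172; -1419; -3142; -3648; -375; 1972; -974; -3795; 2134; 2308; -632; -5452; 595; -4036]);
  (15229, [:: -3237; -1287; -11041; -4458; -2258; -4129; 2979; 12770; -3073; 11465; -2644; 13116; 7214; 8419], [:: 3126;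
  -3250; 1936; 1066; 576; 2001; 2054; 2958; 1780; -3077; -3257; 146; 3913; -162]);
  (16610, [:: 9759; -1114; 6823; 2937; 10278; 9881; 54; -8239; 435; 4861; 528; -10736; -13215], [:: -3254; 993; -1851;
  -2806; -2279; -4221; 2332; 2747; -2689; -3416; -1232; -2365; 472]);
  (16619, [:: -8008; -1519; -7788; 9400; 1496; 14795; 8479; -2375; -2214; 8754; -9010; -4078], [:: 2833; -980; 2698;
  -2182; -2074; 1811; 522; 3836; 5414; 5108; 1486; -1566]);
  (18817, [:: 12789; -321; 8087; -4591; -2658; -3717; 6200; -1264; -16421; -4497; 15940], [:: -2068; 3637; 788; 266;
  5136; -709; 2091; -2513; 5456; -326; 1482]);
  (19742, [:: 11362; -1194; 12838; 12967; 10663; 13183; 9031; -5771; -15945; 14368], [:: -4032; -1931; -711; -4896;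
  -3840; -421; -1366; 673; 3420; -3195]);
  (23647, [:: -14395; 16089; -7445; -1503; -8285; 17773; 14082; -20922; 8420], [:: 2981; -2820; 5118; -761; 4174; 1336;
  -1759; 2676; 1762]);
  (25071, [:: -13406; -1621; 16129; 15480; 6232; 6021; -11150; -15200], [:: 2356; -1590; -2364; -1731; 3099; -4448;
  3638; 4063]);
  (29898, [:: 14745; -19498; -26601; 22348; -8140; -13934; -6153], [:: -3698; 1874; 262; 3631; 2266; 987; 5189]);
  (33981, [:: 16527; -2963; 23922; -25486; 12351; -17796], [:: -2578; 2039; -3657; -4421; -3466; 1967]);
  (41758, [:: 27947; -1403; -28301; -19261; -839], [:: -2031; -235; 5456; 176; 3229]);
  (40930, [:: -33605; -6; 52; -23240], [:: 4426; -1; -3716; 3]);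
  (40925, [:: -40895; 40854; 40839], [:: 5457; -5455; -5455]);
  (81761, [:: 70; -81702], [:: -5455; 3]);
  (81770, [:: -81712], [:: 5457]);
  (163359, [::], [::])].

Lemma lu28_certified : certified 28 10045 10000 32 5461 lu28.
Proof. by vm_cast_no_check (erefl true). Qed.

(** Growth is 123021 / 309, about 398.13, that is 3.3177 times the order. A coarse scale is enough:
    the first pivot is 309 and [q] is 2999. In the last but one triple both bounds are attained, |c|
    = p and u = q, and the last pivot 123021 is 2 * 61511 - 1. *)
Definition lu120 : seq (Z * seq Z * seq Z) :=
  [:: (309, [:: -299; 92; 271; 224; 256; 215; 177; -159; 156; 128; 8; -111; 78; -159; -110; -173; -137; -118; 44; 108;
  -149; 31; -149; 163; -44; -75; 103; 29; -26; -90; -198; -228; -17; 12; 28; 50; 161; -94; 62; 39; 290; 181; 100; -259;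
  -26; -50; -132; -18; 46; 76; -165; -50; -65; 40; -275; -57; -194; -31; -16; 40; -51; 47; 95; -55; -33; 136; -65; 173;
  30; -34; 49; -86; -136; -259; 166; -277; -267; 112; 296; 293; 139; 28; -85; -140; -25; 94; 203; -173; -297; 247; 140;
  -69; 166; 296; -33; 215; 119; -282; 82; -120; -133; -139; -181; 101; 77; -133; -152; 108; 297; 184; -6; 105; 15; -254;
  224; -297; 76; -89; 57], [:: 2995; -2994; -2467; -2339; -1599; -2305; 773; 1163; -2240; -1123; 1315; 84; -1323; 2122;
  -1155; 453; 1490; 540; 190; -802; 491; -167; -328; -1051; 2494; 426; -261; 272; -1326; -1371; 22; 222; 1224; -318;
  -263; -584; -1279; 353; -385; -470; -1277; 130; -653; 1720; -590; -1788; -10; -793; -849; 38; -628; 836; 312; -972; 5;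
  1253; -466; 705; 1559; -152; 2074; -2061; -212; -1032; 1893; 2589; -399; -913; -2535; -278; -1867; 616; -2297; 1722;
  -1838; 822; 89; 1017; -2411; -1967; 2536; -2683; 478; -2600; -417; 1301; -517; -393; 166; -546; 2263; -2986; 2623;
  315; 2956; -102; -1904; 1238; 714; -1340; -2386; 837; 2807; -590; -347; -887; -2991; -440; 868; 2749; -1039; -228;
  -1955; 2123; 2361; 2903; 2876; -2361; -312]);
  (597, [:: 207; -485; 40; 14; 21; -441; -61; 45; -271; -227; 317; -176; 227; -83; 68; -77; 73; 50; 75; 222; -67; 251;
  77; 175; -121; -202; 35; 21; 95; 42; -28; -35; 45; -186; 17; -74; -49; 166; -149; -59; -58; -75; -18; -135; -24; 195;
  223; 128; -12; 249; -216; 203; 142; 15; -121; -104; 162; -269; -225; -43; -8; -186; -79; 332; -318; -25; -250; 215;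
  40; 179; -64; 91; 206; -197; 25; 499; -261; 3; -66; -423; 270; -213; -69; 324; 29; -414; 448; 481; 7; -266; -97; -299;
  -195; 330; -403; -23; 316; -132; -120; -33; -144; 305; -284; 187; 81; 448; -299; -383; -479; 246; -100; -30; 176;
  -442; 593; -74; 170; -35], [:: -2997; 44; 97; -2107; -2238; 1027; 1454; -1033; 624; 1359; 598; -1297; 555; 302; 856;
  349; 182; 486; -1332; -197; -6; -870; -526; 1017; -609; -164; -445; -382; -1271; -529; -1152; -698; -946; 698; -480;
  -1070; 2; -923; -429; -121; 126; -68; -141; -187; -356; 291; -1211; -912; -221; -185; -1065; -1308; -1288; 357; 409;
  -863; -225; 779; 1418; 2310; -634; -268; -135; -51; 1; -685; 532; -1100; -56; 556; 1670; 72; -622; -2400; 1333; 538;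
  643; 285; -1564; 1364; -1248; -393; 182; 1187; 2121; -1747; -1238; 935; -1733; -285; -2936; -157; 1192; 300; 43; -704;
  -141; 542; 825; -29; 1912; 2793; -422; -1145; -1559; -2866; -99; -733; 2332; -1391; -1456; -579; 1585; -316; 2579;
  -45; 212; -1642]);
  (598, [:: -464; 543; 504; -49; -32; 22; -74; 152; 42; 429; -373; 207; -292; 130; -498; 68; 316; 49; 120; -288; 176;
  36; -75; -90; -200; 0; -36; -17; 141; -408; -4; -222; 99; 61; 276; -46; -8; 101; 367; 5; 41; -314; -196; 63; -133;
  230; 232; -163; -195; -334; -112; -115; -556; -253; -328; 329; -440; -240; -10; -238; 199; -394; 369; -155; -389;
  -112; 95; -161; 227; -334; -209; 246; -16; -22; 388; 28; 588; -35; 14; 281; -512; 89; 515; -131; 8; 62; 243; -43;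
  -423; -464; -420; 244; 141; -141; -183; 196; -47; -359; 131; -33; 390; -431; 412; 244; 0; 103; -257; -256; 464; 246;
  178; -24; 71; 143; 39; 377; -274], [:: 1778; -966; -301; 2133; 445; 657; 642; -992; -1493; 867; 1707; -1299; 663; 393;
  283; 631; -908; -706; 737; 708; 1439; 1273; -604; 69; 332; -798; 70; -329; 349; -307; -799; 1017; -1019; 445; 367;
  211; 423; 886; 792; 120; -536; 682; -65; 153; -274; 1691; -1050; 1080; 1599; -1095; 386; 1058; 1372; 429; -459; -124;
  -140; -286; 356; 2036; 118; 824; -1764; -796; 329; 560; -21; 1558; -1153; -1746; 1700; 12; -385; -123; -685; 1114;
  574; -637; -1440; 773; -359; 655; -1663; 530; -632; -1003; 69; 1320; 1239; 1284; -1833; 1025; 921; 930; 775; 1340;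
  -151; 140; -1097; -2287; -2879; 1071; 645; 301; 184; 1591; 810; -1282; 2132; 908; 1221; -1418; -552; -1815; -215;
  -345; 1145]);
  (778, [:: -421; 173; -15; 392; -354; 278; 189; -274; -583; 124; -20; -92; -262; 420; -201; 18; -220; -436; 347; -24;
  11; -264; 58; 204; 79; -188; 14; -47; 192; 98; 172; 170; -261; -154; -60; -98; -41; -97; 209; 101; -104; -139; -11;
  -36; -107; -24; 353; 160; -62; -289; 162; 162; 256; 230; -486; 447; -63; -274; -103; -146; -71; -250; 506; 171; 90;
  -73; 61; 66; 62; -248; -327; 64; -511; -159; 137; -400; 489; 293; -302; 363; -466; -116; 9; 284; 41; -255; -69; 72;
  -78; 582; -196; 125; -32; 26; -644; 38; 134; 112; -389; -91; 631; -426; -553; -122; 318; 659; 383; -163; -241; 182;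
  11; -146; -343; 304; -142; -84], [:: 1440; -1871; 1533; -362; 1752; -323; -628; 403; 1442; 77; -1724; 4; 1164; -316;
  -667; -73; -1173; 467; 323; 1428; 807; 79; -175; 78; -243; 388; 23; -120; 160; -2011; -418; -717; 747; 442; 338; -769;
  559; 1473; 105; 665; -467; -829; 147; -621; 1680; -262; 293; 317; -1297; -922; 329; 1136; 492; -469; -773; -277; 1106;
  2069; 1332; -663; 1407; -643; -229; 805; -166; 8; -108; 1455; -1276; 2997; 167; -2200; 218; 924; 1858; 209; -1819;
  -1204; 67; 525; 735; -454; 256; -145; -124; 677; -1252; -796; 646; -2176; 431; 832; 1597; 1328; 1389; -1146; 1309;
  1305; 681; 194; 1720; 940; 590; 496; 1954; -1070; -1366; 1023; -1433; 2194; 368; -1451; -825; -567; 1724; -1354]);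
  (850, [:: 521; 435; 214; 253; -241; -208; -85; 88; -323; -180; -317; 314; -527; 131; -133; 381; -81; -402; 141; -99;
  -27; -297; -166; 9; 356; -323; 86; -103; -359; -154; -284; -113; 294; 59; 164; 382; 364; 314; -209; -224; -145; 41;
  155; -179; 29; -428; -72; -29; 1; 194; -177; -330; -180; 12; -250; -305; 272; 51; -83; -46; 243; -195; -447; 251; 218;
  -406; -225; -251; -332; 59; -198; 182; -178; 84; 472; -111; -163; -45; -686; 443; -83; 323; 336; -132; 252; 245; 245;
  -460; -48; 550; -186; -145; -275; 308; -263; -410; -396; -128; 316; -326; 278; -41; -243; 270; 89; -164; 444; 248; 96;
  -505; 296; 257; -369; 68; 154], [:: -1274; 628; -1394; -736; -719; 1640; 1278; -318; 356; -466; 494; 868; -175; -1356;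
  1241; -141; 82; 333; 689; -807; -950; 31; 856; -511; -203; 1630; -419; 1155; -374; -759; 514; 485; -130; -986; 462;
  536; -168; -96; 1316; -1153; 44; 118; -512; -420; 1762; 136; 171; 55; -1400; -308; 113; 670; 1277; 347; -301; -78;
  167; 23; -340; -608; -735; -2; 1369; -674; 1273; -167; 886; -505; -53; -1405; -687; -952; 402; -1140; -177; 618; -173;
  -681; 1440; 419; -131; 56; -493; 387; -391; -2097; -1282; 1181; 314; 190; -569; 858; 1748; 161; -567; -126; 2989; 442;
  887; 1400; 741; -254; 90; 1061; -1981; -942; -1502; -2220; 900; -154; -99; 913; -1954; 1589; -976]);
  (818, [:: 569; -102; -452; -85; 133; -184; 79; -415; -249; -116; -165; 51; -309; -189; -47; 11; 28; 185; -46; -278;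
  -174; 234; 283; -258; 8; -233; -55; -72; 139; -18; 2; 59; -338; 46; -26; -16; 269; 277; -196; -175; -301; -153; 1;
  141; -143; -79; -168; -167; 41; 130; -264; -414; -232; 17; -362; -278; 87; -428; -305; 52; 202; -336; -229; 506; -420;
  369; 104; -334; 57; -392; -244; 146; 297; -128; 614; 124; 323; -213; -31; 455; 491; 436; 284; 366; -62; 292; -285;
  325; 288; 525; -530; -158; -54; -436; 23; -453; -179; -61; -229; 363; -57; -244; 333; 609; -197; 479; 263; 445; 45;
  -445; -61; -269; -182; -304], [:: -2318; -494; -16; 1751; -979; 522; -1597; -338; 1796; 139; -257; -1343; 1134; 487;
  1443; -7; 99; -1996; 791; 720; -689; -656; -288; -300; -404; -604; -1052; 1390; -743; 1279; -245; -426; 323; -19;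
  -492; -1211; -786; -1535; -980; 627; 1077; -265; -1308; 392; -513; -2052; 917; 1871; -248; -814; -576; 818; 258; 915;
  -1074; -860; -453; 402; 875; 1510; 646; -2113; -342; -959; -824; -682; 369; -1524; -460; 2602; -644; -988; 372; 1554;
  1182; -2; -283; -1431; 844; 297; -1767; -157; -10; 1057; 96; 572; 401; 593; -820; -275; -336; -2243; -2301; -632; 21;
  106; 1781; -855; -2774; 153; 473; -242; -2965; 839; 1375; -498; 2049; -85; -889; -1116; 789; -246; -1406; -475]);
  (850, [:: -749; -673; 237; -299; 49; 34; -353; -61; 334; -312; -56; -221; -280; 45; 15; 219; -222; 31; 136; 57; 340;
  389; -283; -136; -568; -204; -130; 304; -225; 193; -20; -568; -39; -335; -99; 149; 65; 168; 281; -429; 37; 27; -25;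
  -184; -126; 160; 323; -170; 167; -188; -295; -47; -10; 15; 102; 392; -170; -63; -221; -132; -317; 45; 202; -450; 603;
  333; 227; -276; -5; 145; 420; -266; -188; 221; -326; 257; -365; -191; 584; 773; 21; 604; 615; -126; 508; -178; 462;
  351; 662; -339; -128; -81; -11; -190; -824; -167; -315; -555; 50; -266; 413; 119; 174; -101; -88; 335; -205; 355;
  -834; 49; -20; 5; -283], [:: 1774; 1134; 615; 1006; -2419; 2195; 167; -805; -786; -710; 1622; -682; -105; -1771; 284;
  -665; 1993; 335; -1476; 1132; -403; -393; 1148; -639; 1302; 747; -370; 307; -761; -321; -132; 778; -235; -19; 1365;
  670; 564; -192; -832; -1231; 945; 1860; -477; 804; 1158; 74; 387; -49; -292; -854; -447; -949; -1821; 1338; 260; 344;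
  5; 43; -1253; -964; 1910; 1871; 49; 561; -609; -662; 730; -441; -1139; -369; 1444; -429; -1362; -1292; 365; 242; 806;
  345; 651; 753; -419; -701; -979; 205; 813; -995; -1517; 165; 252; -1155; 2221; 208; -556; 289; -767; -762; -1617; 373;
  -1026; 1155; -46; 1298; -532; -1211; 2567; 938; 1214; -583; -664; -2956; 1284; 1389; 682]);
  (948, [:: 188; -533; -118; 139; -419; -117; -319; -15; 385; -239; -112; 222; 89; -91; 40; 43; -248; -458; -42; -365;
  -442; 173; 128; 239; 409; -261; -456; -214; -71; 225; 253; -61; 341; -66; 164; -247; -334; -216; 511; 133; -152; 113;
  -104; 277; 93; -38; -82; -147; -51; 382; 109; 228; 117; 151; -361; 283; 344; -236; 475; 139; 412; -31; -5; -692; -354;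
  -417; 419; -96; 5; -562; 68; 396; 193; 421; 0; 350; 7; -211; 58; 560; -510; -44; -184; 285; 251; -62; 172; -234; -132;
  227; 138; 145; -229; 525; -121; 48; 489; 261; 320; -593; -87; 470; 119; 241; -395; 540; -128; 504; 189; -112; 187;
  514], [:: 53; 1663; 1278; -1648; 2139; 347; 877; -1069; -904; 1415; -518; -739; -684; 562; -421; 1201; 783; -392; -29;
  161; 41; 300; -1192; 716; -307; -534; 997; -148; -746; -631; 181; -810; -958; 101; 882; -943; 439; 401; -1148; 2157;
  -19; -575; 233; 325; -705; 246; -80; -1543; -253; -1017; 222; -249; 1674; -625; 193; -621; -1104; -372; -1826; 447;
  1159; -1089; 799; -1728; -185; 30; -1707; -161; 1162; 931; 279; -175; -446; 1880; -319; -595; -114; 446; 110; -1573;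
  -2069; -1386; 253; 175; -1220; -1227; 1186; -1350; -2655; -309; -132; 993; -484; -512; 805; -42; -1236; -856; 295;
  -143; 379; -555; -397; 2419; 801; -960; 115; -1561; -1959; 2040; -455; 71]);
  (871, [:: -588; 259; 489; -81; 374; 177; 114; 538; -195; 3; -152; 309; 219; -116; 3; 74; 36; -213; -419; -56; 47;
  -156; 491; 157; 193; -59; 24; 165; -56; 186; 106; 478; -99; -134; -257; -5; 213; 168; 282; -61; -328; -65; -177; 111;
  -288; 7; 173; -320; 276; 89; -362; 2; -66; 217; 430; 55; 160; 13; -218; -234; -23; 272; -208; -376; 293; 335; -238;
  661; -27; 277; 355; -719; 311; 5; -216; 227; -652; 60; -47; -140; -372; -121; -107; 466; -567; 340; -243; 372; -325;
  457; -223; 378; -64; 93; 383; 64; -214; 77; -589; -372; -10; 285; -264; -234; -337; 1; 867; 91; -557; 3; -39], [::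
  1456; -1539; -1836; 322; -1326; 676; 83; -848; 716; -93; -505; -1377; 658; -137; 339; 1496; -428; 836; -666; -1099;
  -22; -1775; -402; -1221; -2; -961; -191; -651; -233; 988; 246; -1093; 805; -814; -243; -236; 7; -624; -93; 1002;
  -1049; 355; -13; 136; 329; 475; -873; 374; -1422; -1442; -374; 87; 1205; -824; -233; 2264; 1163; -643; 237; 4; -1398;
  -1264; -1063; 621; -480; 121; -28; -138; 1757; 114; -475; -2689; -970; 760; 845; 1449; 1409; -919; -307; 629; -442;
  1027; 2227; -943; -46; 706; 2038; 817; 1261; 122; -1952; -227; -2061; -375; -223; 265; 504; 2138; -26; -1275; -541;
  1287; 1606; 939; 296; 820; -1919; -1881; 273; 1163; 385]);
  (958, [:: -318; -64; 341; 432; -133; 98; -669; 364; 351; 109; 53; -397; -190; 127; 131; 444; 316; -47; 199; -35; 109;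
  -20; -178; -185; 7; -30; -30; 39; -26; 238; 2; 500; 295; 241; 258; -107; 52; -199; 111; 318; 291; 271; -203; 381; 474;
  -511; 271; -185; -151; 121; -227; 371; 185; -159; 268; 390; -271; 275; -145; 109; 120; -5; 432; 32; -515; 716; -291;
  -312; -173; -394; -35; -740; -409; 253; 51; 212; -40; -132; 335; -477; 173; -509; -565; 484; 8; 131; 583; 502; -685;
  173; -43; -112; 41; 126; 1; -45; -353; 343; -232; -697; -42; -330; 359; -150; -171; -512; 145; 364; 203; -16], [::
  649; -2024; -247; -1094; 1956; -775; -422; -342; -750; -1062; -438; 1271; 801; -382; 668; 98; -274; 866; -544; 483;
  -329; -158; -149; 340; -617; 675; -185; 183; 481; -220; -733; -547; -46; -1156; -1070; 1076; 621; -18; -208; -641;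
  778; -894; 241; -565; -552; -830; 743; 209; 571; 802; 938; -618; -63; 641; -406; 749; -712; -17; -723; -1530; -1322;
  -1329; -291; -42; -540; 2167; -353; 1682; -1293; -527; -1062; 925; 1505; 905; 2095; 1747; -259; -1133; -1351; -1797;
  1767; 1836; -903; -845; 1210; 58; -1614; -411; 121; 400; -1153; 256; -286; -1413; -1733; -763; 1051; 1339; -916; -906;
  1431; 2295; 1939; -655; 891; -2101; -1883; -671; -506; 134]);
  (974, [:: 437; -231; 521; 366; -221; 273; -61; -311; -91; 46; 334; -86; -47; 445; 34; 48; 122; 97; -530; 201; -85;
  130; 415; 188; 203; 28; -324; 180; 168; -12; 195; -353; 212; 165; 35; -353; 10; 58; -149; 447; -549; 40; -245; -85;
  253; 224; -327; -131; -189; 16; -822; 138; -88; -467; -139; 530; -398; -683; 234; -8; 4; -11; -171; 343; -441; -70;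
  -103; 706; 294; -325; 653; 269; 296; -490; -499; -569; -147; 105; -268; -368; 5; 284; -531; -12; -308; 447; -435;
  -374; 139; 244; -89; -88; 338; 495; -71; -280; -291; 46; -16; 31; -381; 168; 20; 421; 517; -261; 219; -46; -694], [::
  -1098; 1262; -933; 1126; 206; 673; 1068; -976; -419; -818; -770; 277; 1166; -1166; -481; 133; -121; -931; 1226; 394;
  1141; 1035; -397; -563; 566; 3; -92; -829; 325; -361; -723; 1447; 397; 103; -63; 204; 782; 306; -608; 1001; 583; -90;
  -178; -937; -440; 393; 1146; 1265; -97; 1216; 454; 266; -776; -928; -879; -1040; 1600; 595; -733; -869; -873; -106;
  673; -367; 568; 951; 6; -2241; 133; -752; 1209; -727; -92; 1284; 2020; 38; -1762; -184; -154; 481; -432; -131; -239;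
  1131; -2222; -927; 1009; -421; 491; 451; 337; 109; 986; -425; -2140; -1339; 819; -402; -2073; -844; 935; 690; -504;
  183; 435; 522; 592; -238; -1236]);
  (1023, [:: 304; 250; 377; 645; -234; -315; -271; -236; -68; -89; 63; 119; 242; -109; 449; -424; 331; -586; -78; -123;
  -209; 285; -181; 238; 547; 201; 106; -189; 437; -57; 123; 90; 173; 373; -117; 173; 392; 133; 118; -342; 409; 16; -127;
  -41; -237; -313; -85; -199; 118; 141; 565; 182; -5; 15; -19; 97; -29; 350; 307; -277; 253; -40; 93; 468; 137; -177;
  -187; -122; -822; 212; 335; 193; -64; -275; -125; -301; 259; -549; -808; 111; -16; -360; 367; -90; 637; 310; 27; -12;
  -205; -205; -162; 305; -232; -339; -98; -501; -99; -115; -55; -889; 512; 83; 182; -87; 373; 371; 684; -84], [:: -1555;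
  27; -1406; -238; 1348; -576; 1062; 1030; 981; 621; -236; -448; -780; 421; -1372; 1015; 121; -231; 410; -919; -306;
  -710; -367; 226; 133; -763; 260; -301; 715; -950; 1; -662; -1379; -910; 183; -1287; -1478; 828; -1268; 103; -708;
  -635; -418; 264; -317; 1198; 547; 1345; -227; -609; 1007; 869; 706; 361; 1375; -2035; 257; 770; 266; 2450; 591; 476;
  867; -287; 482; 184; 2233; -269; 2008; 609; 72; -754; -520; -1075; 1423; -271; 644; 72; -765; -302; 115; -983; -1481;
  1113; 1607; -765; -859; 130; 1133; 2483; 230; 864; 718; 1731; -997; 118; -269; 177; -559; -2218; -709; 562; 789; 841;
  1346; -272; 209; 247]);
  (997, [:: 290; 273; 496; -618; -135; 347; -106; -206; 166; -316; 16; -221; -36; -106; -21; 295; 19; -236; 86; -620;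
  245; -135; 251; 429; 42; -185; 199; 20; 66; 0; 379; 268; -32; -286; -245; 503; 409; 86; 158; -140; -74; -137; -126;
  -212; -140; 159; 110; -436; 22; 77; -78; -202; 544; -581; 355; -394; 391; -41; 222; 454; 136; 112; 72; -255; 230;
  -448; -314; -216; -559; -244; -427; 832; -343; 172; -545; -69; -701; -281; 66; 16; 161; 242; -168; 606; -18; -69;
  -455; 50; -291; 572; 126; -261; -109; -153; -256; 287; -710; -195; 89; 216; 101; -614; -484; 345; 254; 384; 193], [::
  -974; -618; -1140; 298; 319; -1755; -1088; -1558; -1173; -659; 721; 529; 645; 90; -640; -217; -101; -589; 145; 1559;
  -145; -107; -1419; -542; -358; -549; 404; -511; 12; 1270; 487; 543; -663; -38; 329; 429; -13; 603; 89; 4; 406; -82;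
  299; 875; -1078; -1258; -1884; 824; 38; -1190; -1438; 535; 370; -1605; 1227; 839; -9; -307; -863; -1255; 31; -927;
  -1441; 1504; -326; -155; -433; -2341; 1061; -5; 1205; -1382; -389; -206; 464; -51; 907; -114; -273; -913; -542; -533;
  -1786; -878; 84; -242; -77; 1124; 446; 1574; 1374; 1329; -1018; 1385; 536; 1780; -1909; -2137; 2246; -306; -705; -325;
  -1274; 37; 1026; 1185; -149]);
  (1040, [:: 425; 537; -84; 451; -163; -441; 174; -35; -240; -222; -16; 126; -149; -137; 211; -159; -259; -35; -11; 392;
  -34; -139; 253; -25; 203; 381; 335; 71; 143; 255; 24; 174; -76; -156; 484; 43; 114; 317; 50; -168; 309; 119; 342; 19;
  -148; -57; -264; -138; 244; -382; -53; 324; -397; 95; -816; 24; 515; 241; 21; 573; -135; 152; 125; -392; -107; -44;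
  -40; 51; 91; -18; -232; -285; 265; -488; 142; -419; 236; -83; 409; -37; -231; -391; 996; -167; -477; -467; 727; -130;
  -12; -139; 446; -35; -699; -425; -337; -697; -239; -794; 335; 9; -384; 97; 395; 320; -203; -402], [:: -1725; 88; -956;
  -907; 1612; 1680; 776; -676; 509; 39; -94; -120; 512; 305; 909; 302; 552; 610; -114; -457; 1396; -614; -360; 847;
  -761; -514; 441; 357; 119; 770; 893; 845; 267; 689; -238; 1362; -712; -608; 374; 1343; 592; 33; -639; -630; 138; 77;
  -164; 116; 147; -316; 571; -1471; 1299; -970; 1261; 499; 1370; 1127; 525; -1069; -184; 421; -414; -443; 1845; 1869;
  1887; -273; -728; -148; -483; -2583; -364; -460; -1439; 1473; -416; -1369; 1456; 799; 69; 1067; 1164; 682; 508; 602;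
  -968; 744; -1115; -2424; -1094; 59; 547; -1617; 1453; 2103; -147; -1385; 83; 2123; -2607; -279; 766; 253; 617; 1307]);
  (1034, [:: 937; 59; -182; 64; -553; -391; -255; -241; -385; -21; -412; 38; -257; 545; -286; -392; -164; -349; 322;
  -103; -14; 73; -43; 322; 76; 418; -218; -82; 248; 24; 78; 184; -35; 353; 300; -74; 414; 50; -437; 16; -15; -274; 491;
  -202; -183; 198; 277; 176; -217; -102; -235; -225; -119; -86; -151; 278; 216; -210; 790; -330; -44; 520; 505; -388;
  -579; -731; 107; 369; -415; 321; -50; -120; -943; -125; 105; -318; 287; 478; 144; -28; 68; 740; 35; -216; -252; -43;
  209; -313; -327; 75; -192; -449; -465; 259; -566; -452; -809; 72; -355; 25; -606; 165; 203; 505; 2], [:: -1247; -1362;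
  836; -1234; 30; 1010; 1386; -643; -1027; 486; 202; 675; 653; -164; 269; 175; -564; 235; 443; 458; 1122; 180; -366;
  186; -969; -631; 487; 133; -205; -47; 442; -782; 363; -576; 779; -705; -823; 168; 314; 760; -1613; 5; -559; -515; 618;
  -1177; 6; -1525; 523; -2047; 410; -955; 698; -1092; -1534; 256; -675; -405; -19; 275; 1924; -1363; 900; -338; -442;
  45; 1263; -678; 899; -827; 1921; -189; 1354; -308; -717; 24; 1763; -705; 59; 892; -248; -1960; -250; -1113; 541; -256;
  -1621; 234; -796; -1481; 981; 19; 1206; -1950; -759; 343; -127; 870; -2180; 607; -1094; -1071; -693; -2117; -1203]);
  (1073, [:: -736; -44; -48; -12; -509; -258; -325; -541; -264; 21; 382; 148; 511; -322; -313; -271; -89; -98; -329;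
  -211; 12; 131; 64; -184; 422; -323; 17; 132; 322; -8; -83; -343; 281; 403; 291; 331; 401; 247; 120; 81; 179; 30; -422;
  197; 206; 95; -91; 214; 178; 173; 135; 398; 126; -4; 411; 327; 570; 590; -652; 221; 251; -384; -444; -582; -470; 78;
  235; -311; 345; 106; 530; -681; -343; -775; 29; 84; 19; 367; 536; 3; 518; 96; -237; 239; 199; -238; -294; -64; 415;
  -103; -137; -405; 443; -103; -348; -267; -26; 143; -267; -887; 381; 648; 601; 606], [:: 2480; -733; -164; -1057; -345;
  -1500; 1112; 1553; -399; -804; -1181; -38; -1266; -1143; 989; 1058; -949; -529; -313; 167; 49; 911; -142; 1444; -208;
  -600; -58; -777; -456; -719; 1359; -112; 445; -2293; 1466; 1506; -1095; -863; -1268; 1752; 24; 451; 669; -88; 1431;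
  332; 1568; -642; 1380; -1227; 1060; -343; -1500; -174; 37; -1815; 434; 263; -872; -1813; 15; -547; -2589; -397; -688;
  -2657; -755; -238; 2102; -596; -1055; -836; 808; -771; 703; -1039; 119; 1392; -76; 349; 1012; -710; 1463; 217; -773;
  936; 191; 1383; 329; -2041; -625; -119; -151; 649; 64; -471; -1930; 804; -338; 808; 1239; -1301; 86; -1338]);
  (1078, [:: 424; 374; -461; 564; 389; -109; -193; -230; -350; -210; -381; -63; 150; -229; -11; 370; -2; 428; 96; -144;
  50; -37; 236; 136; -159; 92; 23; -128; -93; 292; 152; 87; -343; -421; 546; -476; -590; 200; 66; 7; 485; 279; -330;
  113; 153; 370; -102; 63; -16; -570; -236; -92; -545; 174; 162; -557; 177; 660; -432; 98; 55; 368; 496; 402; -407;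
  -435; 421; 247; 136; 167; -38; -223; 1025; -96; -180; 896; 112; -264; -180; -342; -222; -132; -197; -64; 380; 116;
  -579; -5; 70; 285; 394; -552; -228; 380; -63; 138; -359; 34; 322; -415; -780; -942; -677], [:: -2089; -1025; -533;
  -1261; -1647; 198; 1294; -731; 1397; -1541; 781; -1141; -1287; 1214; 1199; -2; -886; -984; -278; -298; 1111; -522;
  607; 548; -403; 1340; -464; -685; -701; 1103; -7; 308; -844; 1804; 867; -522; -108; -981; 1489; -382; 1157; -539; 367;
  2355; 587; 358; -1055; 1994; 687; 1099; -1336; -446; -104; 406; -1416; -179; -294; 366; -1842; -431; -1164; -67; -858;
  -338; -1282; 936; 279; 945; -417; -534; 726; 817; -219; 662; -426; -141; 990; -380; -327; -700; -2630; 1810; -205;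
  742; 2414; 743; 486; -855; -1536; 1383; 1257; 1507; -428; 228; 1065; 236; 958; 643; 538; 1465; -1304; -756; 227]);
  (1077, [:: 554; -552; 364; -148; 54; -133; -560; 192; -123; 16; 350; 367; 34; 142; 82; 121; 75; -6; -70; 62; 165; 377;
  446; -103; 567; 354; 277; 23; 338; -115; 309; -173; -170; 403; -378; -609; 573; -8; 18; 41; 39; 283; 101; 439; 427;
  -275; 400; 567; -916; 264; -249; -109; 680; 246; -130; 65; 406; -298; -483; -548; 431; -6; 507; -240; -180; 137; 538;
  -10; -25; -198; 279; 554; 465; -223; -55; 683; -443; -422; -416; -298; -306; -75; 616; 473; 181; -267; -216; -321;
  -25; 633; -586; -475; 384; 54; 573; 305; 30; -555; -379; -323; -478; -327], [:: -1164; 733; -256; 1843; -1060; 1151;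
  862; -1776; 926; 503; -1028; 540; -1423; -166; -386; -380; -54; -168; -21; -1954; -319; -184; -970; 79; -980; -354;
  -577; -1236; -1449; 241; 481; 614; -1014; 324; -56; -147; 385; -713; 39; 703; 166; -568; -409; -385; 675; 458; -2271;
  344; -1816; 2277; 965; 847; 881; 89; -203; 915; -981; -356; 544; -359; -549; -1775; -1217; 1159; -257; -556; -1874;
  -366; 1368; -263; -684; 52; 91; 383; -1468; -29; 1220; 640; 418; 621; -1141; -688; -579; -364; -1118; 1468; 2663; 905;
  -1253; 222; -1449; -1940; -96; -1183; -43; -818; -310; -393; 383; 320; -800; -904]);
  (1100, [:: -658; -84; -265; -545; -488; -195; -197; -310; 157; 355; 405; 30; 363; -190; 39; -34; -181; -516; -3; -103;
  198; 305; 291; 409; 298; 562; -347; -16; 216; -128; 17; -143; 369; -665; -425; 532; -231; -393; 247; -149; -109; 271;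
  606; 119; 39; -87; 234; -823; 357; 86; -502; -289; -206; -128; 449; 10; -704; 178; -209; -235; 108; -264; -931; -516;
  -476; 720; -19; -105; -481; -527; 261; -334; 412; 535; 687; -283; -584; -305; 38; -624; -334; 154; 511; 529; 67; -348;
  -476; 38; 43; -26; -281; 547; 164; 400; -450; 9; -801; 3; -23; -407; 164], [:: 1282; 1572; -1001; 1178; -56; -488;
  -377; 327; -181; 861; -128; -311; -341; -498; -436; -225; 489; 470; 630; 203; -742; 178; -848; -270; -51; 395; 831;
  456; 77; -800; 40; 273; -392; 516; 1270; 700; -56; -505; 240; 859; 363; -212; -458; 84; -590; 698; -1537; 1758; -2273;
  -384; 202; -745; 622; 257; 108; 1688; 1495; 750; -527; 1116; 2261; 1089; 638; -1058; -1772; 448; 193; 212; 12; -669;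
  -194; -1610; 248; 1957; -576; -318; 1276; 330; 668; -614; 1095; 1158; -780; 1245; -185; -902; -669; 148; -1598; -728;
  1327; 766; -1697; -613; 1980; -1300; 1666; -782; 330; 898; 960]);
  (1111, [:: -550; 423; 306; -208; -194; 213; 548; -126; -518; -427; 17; 116; 170; -446; 170; -32; -120; 110; -64; -16;
  -589; -98; -207; -283; -117; -282; 356; -606; 197; 255; 135; 79; -77; 318; -197; 96; 244; -178; -93; 422; -19; -304;
  -335; 784; -239; -199; 393; 318; 314; -133; -44; -199; -23; -384; 51; 746; 193; 547; 223; -468; 225; -98; 209; 26;
  316; -168; 31; 409; -521; -876; -162; -281; 95; -514; 486; 723; -67; 427; 422; 279; -459; 305; 294; 342; 517; 451; 71;
  298; 461; 50; -399; -16; -360; 59; 124; 236; -392; 518; 818; 41], [:: 1788; -1083; -987; 910; -777; -1372; 855; 1282;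
  452; -160; 927; -527; -748; -780; 231; -50; -543; 533; -783; -854; -228; -378; 389; 547; -259; -405; -650; 1005; -754;
  1534; -1389; -16; 1473; 698; 448; -43; -239; 1061; -683; 368; -498; -805; 107; -1200; 687; 148; 1818; -27; -225; -386;
  336; 1617; 414; -1271; 1436; 1148; 222; -1217; 1420; 217; 1620; 185; -358; 110; -66; 962; -715; 299; -945; 229; -1577;
  737; -240; -129; -1050; 1823; -743; 1010; -2244; 299; -29; 722; 1669; 398; 269; 703; -250; -410; -1751; -1316; 1124;
  -1792; 766; 2163; -1900; 1020; 292; -1196; -898; -424]);
  (1121, [:: 505; -121; 412; 241; 314; -312; 83; -125; 408; -309; -36; 91; 302; -87; 218; 109; 160; 3; -100; 346; -40;
  156; 240; 116; 470; 38; 98; 197; -332; -246; 245; -42; 119; 98; -234; -121; -150; 759; -413; -166; 80; -61; -470; 463;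
  625; -361; -491; -282; 579; 174; 808; -293; -354; 341; -657; -377; 257; 270; 459; 262; -32; -619; -192; -593; 224;
  217; 79; 368; 508; -33; 47; -129; -236; 404; -371; -387; -618; 245; 371; 379; -820; 52; -234; 88; -224; -282; -2;
  -844; 224; 52; 233; -94; -338; -445; 61; 49; -850; -730; -245], [:: -1292; -612; -636; -991; -973; 668; -655; 1587;
  -444; 1450; -1078; -487; -589; 1191; -360; 69; 368; -475; 251; -439; -347; -268; -336; 1006; -217; -66; 655; -1179;
  -20; -1719; -411; -47; 853; -196; -150; -612; -1022; -913; -255; -290; -1305; -563; -1172; -603; -215; 203; -571;
  -1915; 168; -412; 985; 587; 1088; 1017; 1413; 1020; -1332; -365; 339; 469; 254; -65; 381; 1079; 68; -377; -14; -163;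
  671; -572; 611; 1408; 122; -2029; 973; -627; -138; -1013; 231; 1165; 55; 847; -777; -1136; 1009; -1624; -645; -2451;
  1213; -364; -250; 61; 1257; -426; 1072; -1368; -1511; -1366; -1950]);
  (1130, [:: -590; -81; -210; -115; -314; -46; -441; -113; -111; 186; 50; 160; 21; -100; 99; -28; -588; -273; -213; 14;
  -153; -110; 399; -70; -205; -301; 117; -393; -57; 272; 24; 520; -489; 52; -66; -235; 15; -492; -149; -838; -298; -149;
  -507; 305; 210; 346; 9; 175; -336; 770; 427; -112; 556; -481; 467; 108; 109; 340; 404; -725; -286; 111; -30; -257;
  135; -531; -956; 22; -85; 164; 927; -223; 292; -315; -428; -668; 485; 301; 411; -185; 683; 193; 215; 451; -187; -368;
  201; -209; -151; 45; -667; -712; -708; -175; -241; -388; -233; -361], [:: 1747; -896; 1754; -189; 265; 1149; 267; 968;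
  -672; 394; -20; -177; -1028; 334; 28; -747; 1340; -64; 117; -211; -1246; -867; -1317; 1297; 387; -573; -223; 649; 343;
  -1356; -1110; -1729; 1243; -809; -12; 806; 983; 608; -1027; 840; 1490; 1920; -637; -1144; -389; 131; -573; -203; 687;
  -491; -988; 204; -1370; -743; -1060; 1298; 224; -981; -1031; 956; 337; 529; -1359; 202; -204; -57; 395; -611; 946;
  135; -72; -1474; 2398; -320; 1723; -484; 1992; 156; -2102; -863; -368; 441; -335; 450; -259; -426; 87; 1260; -682;
  -584; -233; -241; 1231; -510; -1532; 354; 1568; 91]);
  (1134, [:: 538; -201; 318; 503; -376; -85; 167; 110; -353; -95; 178; 365; 426; 157; 166; 459; -133; 35; -634; 217;
  125; -622; 57; 332; -18; 119; 371; -45; -27; 459; -396; -212; 55; -308; 14; 267; 624; -8; 136; 184; 445; 182; -15;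
  -423; 0; 101; -99; 165; -527; -729; 9; 279; 685; -103; 226; -81; -44; -98; 399; 609; 385; 107; 210; -311; 838; 981;
  489; -133; 304; -725; -484; -216; 352; 228; 3; 79; 246; -26; -305; 22; -90; 115; -469; -116; 490; -35; 574; -338; 251;
  468; 836; 523; 124; -462; -446; 19; 362], [:: -1204; 1290; -745; -546; 1249; 315; -489; -304; 807; 138; -410; -1032;
  868; -21; -186; 332; 243; 263; -240; -1025; -1175; 24; 1958; 1493; -889; -322; -793; 716; -604; -1294; -836; 1341;
  -463; -375; 789; 1744; -465; -91; -611; 561; 1068; -375; -2281; 776; -558; -692; 269; 524; -2567; -1491; -832; -431;
  -133; -148; 1033; -540; 247; -1394; 1051; 308; 93; 1260; -484; -902; -881; 725; -844; 1311; 862; 2323; 759; 1005;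
  -1308; 296; 436; 909; 1743; -613; -543; -307; 500; -1921; -894; -584; -1465; -389; 475; 288; 271; -1761; 836; -976;
  -925; 80; -1595; 639; 853]);
  (1129, [:: 710; 416; -284; -331; 74; 49; 477; 20; 4; 668; -204; 339; 0; -154; 381; 44; 15; 127; 182; 82; -114; 486; 2;
  -34; -330; -51; -406; -234; -32; 293; -332; -336; -662; -425; 285; -340; -375; -249; -279; -262; -74; -130; -44; -286;
  -65; 569; -94; 209; -45; -155; -318; 325; -219; 576; -555; -513; 61; -385; 93; 406; -652; 495; -743; 346; 360; 240;
  133; 532; -63; -846; -96; 72; 91; -229; 798; -416; -72; -518; 70; 57; -683; -293; 61; 156; 101; 151; -864; 205; -394;
  179; 271; -391; 377; -524; -546; 507], [:: -1472; 390; 1317; 362; -1206; -4; -369; 1384; 682; -930; 888; -916; 784;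
  1171; -893; 130; 256; 369; 651; 47; 778; -844; -497; 367; 1069; 468; 699; 1126; 441; 532; 293; 906; 583; 798; -194;
  -295; 1317; 690; 316; -681; 484; 628; 397; 509; 965; -1274; 1087; 660; 1337; -173; 1680; -1353; -1410; 314; -491; 310;
  1025; -1865; -1445; -1133; -1837; 40; 16; 346; -1099; -1252; 96; 392; -321; 1451; -530; 1460; -411; -594; -296; -239;
  -1420; -840; 919; 708; 1694; -1988; 309; -262; 91; -698; -588; -1916; 1001; 807; 197; 999; -629; 1077; 597; -651]);
  (1171, [:: 627; 211; 392; 287; -102; 396; 24; 435; -101; 125; 306; -135; -154; 76; 301; -31; 512; 118; 1; -132; 128;
  -26; -101; 5; -201; 176; -272; 45; 304; 47; -254; 173; -140; -112; -505; 211; -27; -72; 14; 395; -60; -66; -804; 192;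
  553; -50; 226; 344; 84; -242; -282; -462; -112; -21; -116; -486; -110; -442; -48; -1019; 456; -642; -271; -187; -238;
  -303; 528; -239; -876; -194; 119; 480; -63; 421; -384; -796; -156; -37; -394; -70; -45; -172; 569; -176; 363; -16;
  -477; 335; -230; 605; 440; 701; -69; -98; 421], [:: -2094; 6; 24; -400; 278; -890; 160; -1466; -368; -1136; -318;
  -318; -1691; -191; -589; -151; -646; -732; -378; -435; 1128; -237; -673; -937; 51; -74; -171; -720; -838; 64; 202; 41;
  -437; 924; -98; 102; -221; 1178; 786; -1224; -1139; -160; 974; 254; 948; 243; -1085; -2491; -899; -2017; -1032; -202;
  -1357; -79; -1332; -577; 1615; 1574; -426; 708; -1831; -1331; 1088; 884; 711; 743; -1481; -372; -237; 2057; -443; 997;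
  957; -268; 279; 712; 125; 418; 1131; -674; 1715; 36; 573; -66; 337; -843; 1012; -2395; -665; -2171; -1308; -576;
  -1950; 1011; 1470]);
  (1174, [:: 661; 658; 325; 371; 70; -142; 204; -407; -25; 249; -405; -136; 179; 389; 54; -188; 106; 115; 33; -57; 2;
  -513; -43; -9; 302; 52; 146; 345; -137; -29; 328; 52; 222; -188; 258; 94; -94; 444; 921; 42; -592; -354; -12; 503;
  334; 122; 454; 29; 393; 60; -206; -278; 220; -134; -640; -280; -469; -757; -499; 42; 172; 337; -197; -89; 145; 618;
  -973; -895; 560; 402; -384; -794; 259; 393; 98; -9; -99; -200; -139; -396; -618; 484; -476; -3; -402; -435; 767; 398;
  911; 83; 39; 92; 153; 444], [:: -1893; -738; 512; -539; -103; -956; 89; -63; -285; 765; 576; 1038; 240; -732; -459;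
  -105; 271; 271; -150; -1240; 564; 594; 1027; 598; -247; 246; 353; 48; -626; -1232; -109; -457; -839; 1094; -368; 1388;
  -1261; -860; 1017; 1624; 436; -843; -286; -176; 90; -672; -378; 155; -433; -395; -269; 1171; 1288; 1714; 914; 274;
  -189; 310; -97; 1497; 6; 1074; 909; -683; -317; 444; 893; -1812; -1451; -278; -127; -2758; 1380; -250; 1548; 1207;
  563; -1573; 114; -598; 1354; 130; 1863; 708; -1018; -75; 2014; -1568; 1176; 324; 1285; 2521; -1928; -1294]);
  (1210, [:: 492; 438; -248; 104; -650; 466; -865; 28; 484; -15; -48; 113; 145; -8; -726; 67; -48; -417; -450; 205;
  -103; 288; 101; 174; 412; 459; -277; -206; -151; 277; -33; 13; -137; 427; 389; 340; 756; 937; 59; 77; -6; 482; -9;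
  569; -259; 101; 47; 596; 89; 41; -402; -122; 30; -962; -170; -414; 210; 266; 42; 323; 68; -102; -355; -49; 321; -1014;
  41; -9; 51; -445; -292; -638; 133; -8; 15; -758; -244; 294; 132; 149; 41; -541; 399; -299; -324; 1139; 349; 849; 226;
  409; 686; 749; -36], [:: -1505; -595; 958; -47; 1064; -87; 924; 490; -1852; 483; 340; -677; 1242; -487; 1026; -667;
  618; 790; 855; -400; -178; -560; 72; -338; -673; -295; 1623; 1064; 1192; 788; -444; 16; -1780; 145; -12; -327; 73;
  -885; -248; -2085; 664; 94; -798; 693; 195; 476; 562; 1160; -184; 576; -105; -737; -691; -166; 140; -862; 53; -1139;
  -625; -158; -310; -556; 839; -1550; -1000; -1249; 553; 1605; 1431; -503; 133; -852; -1811; -374; -2757; -755; -400;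
  -99; 739; 516; -982; 377; -439; -160; -1136; 20; 1393; 1128; 982; -712; 1256; 2277; -663]);
  (1244, [:: 794; 459; -132; -418; 374; -284; -33; 79; 54; -390; 12; 472; -166; -171; -305; 5; 281; 89; -159; -102; 98;
  40; 445; 87; 74; 163; -268; 191; 537; -11; 184; 14; 378; -89; -237; -244; 498; 183; -154; -458; 237; 583; 177; 240;
  401; 409; -120; -569; -617; -441; 117; 50; -871; -91; -514; -873; -131; 264; 294; 46; -205; 164; -111; 228; -794; 586;
  404; -335; -779; -260; -134; -384; 639; -654; -902; -252; -452; 164; -220; -448; -846; 865; 566; 474; 528; 247; 902;
  433; 412; 589; 254; 316], [:: -1151; -1357; -638; 772; -700; -628; -57; 88; -1388; 363; 558; -875; 1011; 336; 992;
  -1189; -247; -262; -617; 537; 86; 70; -227; 908; -79; -708; 1215; -607; -731; 1549; 372; 1516; 210; -315; -83; 888;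
  832; -146; 732; -1637; 981; -1379; 1459; -350; 317; -1081; 630; -711; 196; 683; -76; 0; -958; -1299; 978; 831; 790;
  -506; 1320; -1867; -1653; -1021; 458; 1737; 638; 1830; 995; 860; 393; -373; 58; 1952; -1587; 1096; 718; 1895; -446;
  273; -1124; 772; -233; -1738; 568; -968; 301; -164; -42; -1001; -827; -2733; 557; 1355]);
  (1218, [:: -558; -101; -423; 132; 170; -172; 414; 169; -374; 75; 402; 379; -216; 97; -181; -332; -280; -24; -293; -29;
  392; 375; 225; 273; -212; -148; 206; 221; -139; 59; 12; -216; -6; 148; 220; 342; 345; 248; -796; -275; 462; 583; -168;
  306; 331; -379; -449; 155; -497; -297; 86; -1070; -360; 167; 18; -7; 652; -387; 19; -191; 286; 307; 49; -85; 320; 397;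
  102; -354; -32; 292; -937; -317; 6; -911; 287; -270; -96; 598; -54; 179; -107; 181; -184; 322; 374; 948; -373; 200;
  -69; 588; -274], [:: 1422; 1299; -115; 952; -291; 668; -132; 281; 522; 265; -477; -691; -597; 170; 1224; -278; 470;
  440; 1114; 433; -119; 412; -1486; -153; -119; -158; -566; -188; 72; -1007; -143; -83; -515; 156; -933; 350; -498; 724;
  1561; -1569; 1923; -596; 1722; 76; -866; -138; 1442; 786; -983; 467; 71; 1748; 99; 350; -885; -1408; 70; -373; -36;
  1512; 77; 967; 2; 863; -2127; -155; -627; -1201; 996; -12; 387; 390; -237; 457; 4; 457; 986; 280; -1586; 720; 2269;
  1083; 1112; 841; -57; 950; 130; 577; 518; 56; -136]);
  (1222, [:: -616; -181; -5; 67; 274; 67; -246; 501; 28; 260; 111; 106; -281; -137; 172; 126; 138; 313; -106; -242; -23;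
  73; -496; 97; 481; -343; 191; 56; 646; -199; -32; 175; -587; -298; 249; 342; -416; -127; 211; -298; 260; -280; -708;
  -187; 24; 484; -141; 211; -217; 179; -8; 478; 40; -783; 587; -251; 840; 118; -309; 424; -209; -223; -221; 275; 101;
  107; -203; -120; 468; 561; 397; 53; 368; -774; -228; 242; -340; -174; -405; 875; 479; 423; 102; 410; -277; 145; 254;
  -371; -773; 1166], [:: 1863; 59; 431; -434; -241; 346; 857; -827; -527; -460; -179; 155; -192; 1326; -1667; -438; 863;
  -835; 503; -61; 359; -1780; 482; -388; -157; 520; 944; -236; -682; -1050; -494; 733; 1044; 690; 633; -1388; 1079; 863;
  -1009; 348; 110; 970; 126; -654; 920; 345; 717; -1436; 216; -1693; 1936; 171; -1151; -1511; 191; -243; -1802; -565;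
  1335; 1768; 1313; -930; -2288; -1184; 1147; -584; -1147; 1463; -1760; -1660; 915; 169; -878; -983; 473; -163; -533;
  160; -428; 791; -484; 120; 1128; 1331; 946; -547; 48; 1670; 773; 173]);
  (1250, [:: 768; -61; 236; -265; -372; -44; -648; 130; -230; -13; -55; 123; 0; 323; -204; -345; 108; -283; -259; 281;
  0; -73; 202; -526; 244; -838; -257; -133; -140; -85; -104; 8; 411; -306; -21; -61; 294; 312; 651; -66; 448; 800; 492;
  84; -463; -70; -517; 452; 224; 584; -187; -381; 693; -141; -300; -683; 14; 676; -462; -173; 734; 60; -489; -898; 225;
  173; 307; -507; -717; 435; 515; -49; 237; -692; -458; -146; 618; -481; 32; -52; 311; 257; -423; 184; -302; 34; 304;
  570; 133], [:: -1224; -92; -872; 250; 1043; -514; 524; 337; -531; -717; -388; -410; 453; -455; -27; 1320; 341; 137;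
  147; 83; -849; 925; -325; 521; -362; 705; -628; -858; 128; -1519; -265; -669; -872; 1922; -1525; 1051; 439; -2471;
  -103; 671; 871; -474; 404; 789; -272; -425; -1470; -571; -1835; 1381; 1; -61; 376; -207; 400; -214; -892; 980; 1740;
  -484; 875; -1005; 474; -1244; -367; -1029; 1357; 30; -1152; 482; 2079; -1170; -393; -803; 989; 657; 843; -136; 1576;
  -886; 577; -505; 1961; 1432; -1035; 1082; -394; 199; -1360]);
  (1225, [:: -674; 117; -410; -63; -69; 188; -335; -425; 8; 193; -107; 269; 531; -223; 190; -20; -280; -423; 241; 214;
  -96; 96; 287; -230; -179; 297; -265; 172; -434; 319; -250; -102; -136; 82; -316; 104; -240; 696; -385; -103; 196; 100;
  308; 14; 341; 54; 765; 335; 597; -79; -605; -709; 437; -218; -571; -368; 276; -781; 227; -4; -127; -309; -123; -58;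
  -320; 626; -142; 59; -327; 422; 151; 871; -690; -706; 79; 415; -454; -198; -80; -306; -417; -249; -834; -152; 164;
  -148; 211; 350], [:: 1650; 1611; 830; -514; 1089; 42; 257; 1305; 1147; 402; 419; -379; -334; 698; -862; -668; -91; 81;
  382; -274; -217; 507; 34; 366; -416; 913; 553; -811; 1508; 705; 1012; 769; -996; 793; 161; 274; 1594; -579; -74; -626;
  792; -315; -391; 86; 1110; 484; -1287; -864; 566; -849; 71; 570; 13; -1650; 799; 317; 617; -1708; 1394; 43; -468;
  1306; 1931; -619; -1309; -629; 393; 1755; -35; -1612; 1253; -521; -1507; -288; -1899; -2179; 1486; -1121; 39; -1271;
  904; -161; -528; 2038; 853; 490; 970; -443]);
  (1259, [:: -641; -57; -514; -455; -143; 504; -63; 313; -229; 232; -114; 119; 126; 49; 280; 90; -265; 266; 443; 57;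
  -137; -156; 422; 157; 34; 195; -205; 830; 279; -273; 488; 848; -219; -146; 280; 354; -45; 403; 496; -352; -113; 300;
  -236; -468; -439; -165; -224; -164; -196; 330; 97; -712; 692; 185; -354; -687; -125; -660; -417; -217; -264; -324;
  469; 132; -488; 345; 111; 584; -241; -371; -263; 1002; 848; 296; 228; -261; 485; 504; -216; 28; -468; 1153; 703; 42;
  485; -278; 321], [:: 1843; 369; 680; 687; 55; -53; 1602; 226; -797; -254; 559; -462; 34; -113; -1175; -540; 627; 51;
  -694; 1104; 762; 318; 361; -190; 543; -606; -719; -1096; 838; -451; -199; -353; 880; 399; -442; -233; -1087; -1379;
  -1331; 685; 912; 570; 900; -366; 327; 167; -934; 62; 921; -1313; 160; -259; -1326; 1392; 42; 270; -36; 1316; 868; 562;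
  -375; -1157; 64; -1081; 923; 355; 2105; -425; -2084; 261; -593; 436; -1601; -1596; -2239; 1544; -265; -1175; 551; -50;
  -1503; 98; 467; 717; 966; -778; 484]);
  (1258, [:: 506; 614; 375; -516; 299; 99; 205; 30; -218; -279; 133; 73; 88; 198; -102; -43; -291; -222; -496; -221;
  -78; 167; -362; -254; 310; -224; -154; -308; -113; -544; -273; 142; 77; -503; 132; 322; 560; -233; 270; -6; -488; 218;
  32; -15; -546; -200; 190; -366; -88; 232; -227; -1; -557; 621; 500; 903; -488; 175; 839; 87; 354; -720; 336; -550; 59;
  -684; 52; 324; 464; 12; -101; -1039; -831; 267; -349; 306; -432; 686; -325; 642; -88; -223; 384; -507; 131; -433], [::
  -1201; -817; -586; 710; 204; 1773; -823; -396; -2; 901; -712; 16; -917; 352; -664; -123; -21; -404; 111; 180; -172;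
  -225; 157; -265; 488; 54; -1159; 712; -103; 427; 35; 909; -467; -637; -356; -1391; -1257; -2426; -742; 588; -1178;
  -395; -381; -87; 721; -1098; -1140; 716; 128; 495; 1743; -382; 1422; 384; -1463; -1143; -2183; -975; -373; 140; -263;
  219; -1753; -987; -801; 253; -987; -1866; -315; -1193; 544; 915; -89; -1779; 957; -1038; -208; -414; 647; -386; 970;
  91; 405; -345; 908; 1380]);
  (1267, [:: 592; -253; -304; -419; -5; 62; 431; -283; -20; -212; -409; -88; 369; 181; -413; 118; -702; -315; -413; 433;
  400; 176; 124; -336; 75; 94; -409; 52; -462; -530; -57; 134; -219; 543; -340; -423; -552; -161; -394; 144; 86; -262;
  -242; 343; 209; -394; -456; 266; 468; 374; -30; 278; 14; 322; 450; -272; 55; 802; -317; -4; 185; -167; -801; 450;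
  -355; -205; -358; 988; -510; -248; -666; -901; 103; -120; 188; -113; 708; 415; -179; 454; -112; -555; -460; -84; 61],
  [:: -567; 1068; 815; 631; -243; 468; -186; 841; -336; 931; 635; -915; 13; -599; 473; -976; 904; 516; 387; -596; -401;
  -357; -1317; -779; -27; 1176; 48; -678; -786; 392; 342; -631; 562; 310; -198; 1557; 1455; 611; 966; -680; -282; 662;
  -386; -1581; -24; 933; -1903; -1393; -797; -1555; -1175; -183; -483; -761; -1440; 1591; 1525; 905; -471; -765; -514;
  662; 831; -1; 1625; -853; 824; -220; 247; -530; 787; 16; -728; -49; 204; -326; -1178; -800; -270; 731; 1316; -684;
  1757; -1156; -810]);
  (1294, [:: 809; -219; -623; -148; -334; -201; 141; -357; -474; -13; 171; -75; 188; -103; -520; 152; -328; 43; -343;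
  -126; 21; 202; -49; -385; -587; -270; -187; -35; -140; 316; -118; -344; -225; 374; 579; -495; 421; -614; -229; 98;
  -389; 425; -559; 456; 98; -550; -375; 480; 474; 317; -186; 453; 389; -116; 432; -398; 150; -184; 489; -935; 233; -640;
  -313; -104; -746; -517; 493; -392; 26; -791; 265; -348; -572; 229; -8; -154; 351; 110; -80; -114; 310; 244; 404;
  -257], [:: -1330; -1343; 875; -1141; 101; 599; -1152; -740; -1145; -158; 199; 523; 315; -389; 772; -628; 1480; 85;
  512; -665; -749; 1367; -197; 1033; -857; -634; 637; 847; -337; 8; 738; 65; 166; 663; -1496; 776; 1174; -16; -559; 77;
  -1290; 19; 506; 658; 1204; 1060; -1131; 1420; 1397; 377; 61; -1113; 836; 1445; -670; 709; -1790; 1337; -1021; 738;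
  -692; 1929; 1518; 786; 586; 1766; -827; -946; -113; -2639; -36; -143; -912; -294; -108; 874; -656; -737; -333; -175;
  -18; -351; -525; 325]);
  (1312, [:: -726; -29; -34; -689; -173; 0; -618; -25; 138; -191; 29; 40; 56; -428; -155; 168; 46; -453; 420; -179; 70;
  -191; 90; -480; -712; 389; -253; -171; 361; 137; -491; -449; 504; 205; 374; 548; 504; -584; -73; -501; 335; -629; 498;
  211; 102; -536; 429; 310; 159; 259; 110; -42; -454; -166; 197; 631; 112; 781; -1080; 148; 400; -191; -299; 268; -13;
  -149; 150; 451; 366; 481; -231; -798; -287; 131; -196; 296; 499; 57; 66; 146; 169; 1010; -427], [:: 1810; -156; -253;
  958; -690; -124; 530; 365; -213; -73; -1252; -251; 1187; -37; 949; -395; 27; 34; 327; 96; -1267; -86; 41; 1290; 2004;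
  -425; -1286; 154; -491; 1160; 80; -1499; -598; 10; -625; 319; 128; 1236; 1344; 4; -1217; -888; 525; 1506; -2074; 44;
  -1418; -45; 861; -49; 437; -676; -360; 1594; -875; 2642; -984; 1263; 146; -437; -1484; -1144; 586; 1251; -1059; 617;
  848; 424; 1044; 411; -769; 1220; -212; -687; -494; -392; 1283; -640; 1481; -478; 2084; -1613; -1949]);
  (1323, [:: -756; -258; 457; 669; 153; 9; -423; 456; 77; -52; 55; -217; -226; -252; 64; 191; 155; -613; 323; 143; -145;
  -545; -225; 761; 180; 170; -179; -84; -637; -26; 367; -349; 318; -640; -731; -1279; 946; 142; -483; -90; 690; -35;
  643; 108; 699; -674; -71; -476; -411; -689; 338; 432; 379; -264; -352; -18; -216; 66; 196; -355; -31; 359; -500; 193;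
  137; -86; 31; 530; 560; -363; 6; 241; 860; 63; 250; -547; -1028; -90; 533; -558; -400; 697], [:: 1465; -761; -583;
  -1123; 873; 393; 607; -459; -778; 403; 511; 197; -71; 609; 103; -701; -163; -944; -542; -279; -86; 1596; 271; 864;
  -893; -1511; 1990; 796; 982; -273; -776; -1386; -1129; 505; 883; 227; 105; 321; -825; -619; -1604; -552; -76; -1392;
  997; 277; -580; 743; 530; 479; -1496; 376; -621; 1028; 2314; -7; 239; -945; -1847; 643; -744; 498; 752; -525; -452;
  85; 106; 96; 1144; -1165; 2096; 430; -387; -521; -870; -661; 1944; -573; -541; 1347; -1218; -1884]);
  (1318, [:: 797; -353; -98; 190; 437; 220; 62; 382; -298; 66; 609; 74; 400; -340; -49; -9; -154; -60; 35; 740; 445;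
  402; 240; 64; 150; 703; -96; 236; -325; -778; -230; -186; 7; -540; 244; -605; 9; 300; -117; -646; -189; -214; 793;
  -538; 534; 158; -235; -129; 37; -15; -119; -283; -291; -348; -577; 96; 265; -10; 166; 395; -350; 627; -115; -671; 262;
  586; 659; -344; 718; -143; -385; -1093; -300; 346; 869; 58; 197; -12; 672; -538; 160], [:: -2203; 203; 203; 882;
  -1232; -1155; -722; -1170; 176; 78; -675; -84; -142; -73; -1212; 241; -1307; -606; 912; -217; 983; 291; 387; 273; 804;
  1521; 1114; 172; 798; 1495; -401; -8; 1818; 1187; 868; -968; -1079; 288; 134; -1755; 508; -556; -2140; 1439; 536;
  -337; -199; 654; 541; 343; 1461; -418; 598; -443; -788; 1118; 269; -527; 1684; 279; 803; 228; 2116; 123; -524; -1495;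
  -101; 1998; -1071; 151; 1485; -666; 1097; -1126; 845; 217; 1132; -2039; 2270; -565; -450]);
  (1341, [:: -833; 443; 370; -40; -378; -224; -51; -292; 46; 758; 198; -126; -597; 115; 178; -191; 475; 187; 412; 598;
  -419; -277; 350; 138; 284; 182; 221; -211; -810; -498; -326; -170; -419; -94; -447; -421; -96; 518; -115; -44; -443;
  217; -729; -94; -162; -679; -400; -283; 329; 118; 600; -164; -627; 23; 367; -17; 97; 111; 357; -709; -410; 240; -152;
  -650; 212; 864; -618; -252; -464; 6; -525; -880; 506; 530; 486; -577; -261; 1052; -254; 773], [:: 1401; -559; -1882;
  -701; 1174; 1420; 1347; -709; 130; -552; 800; -115; 283; 387; 604; 1980; -588; 219; 13; -560; 84; -1008; 626; 719;
  -1216; -409; 569; -1477; -832; 539; 71; -1521; 396; 379; 1550; 1204; -1510; 564; 569; -271; 26; -695; -123; 950; 1158;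
  -785; -859; -513; 20; -1947; 1178; -781; 408; 448; -2182; -1433; -210; 34; 1105; 673; 494; -2439; 69; -857; 907; 501;
  -1574; 808; -672; 639; -1205; -1628; -1453; -453; 1044; 1350; 1309; -603; 727; -1586]);
  (1367, [:: -577; 258; 356; -271; 159; 17; 239; 346; -460; -76; 418; 137; -449; -114; -364; -132; -203; 151; -466; 143;
  675; -304; 106; 63; 346; -519; 25; 714; -52; 755; 194; -83; -247; 245; 58; 496; -1041; 267; -775; -147; -22; 997; 537;
  -301; -393; -341; 377; -320; -101; -134; 85; 2; -128; -32; 528; 93; -500; -554; -32; 588; 92; 457; -249; 428; -894;
  432; 486; 34; -444; 491; 127; -465; 87; 78; -477; 653; -1215; 427; 29], [:: 1385; -1573; -1082; 907; 120; 1290; -1369;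
  1009; -17; 43; 74; 298; 371; 1507; 2224; 74; 1097; -301; 244; 46; -337; 748; 1277; -169; -546; 1662; 184; 414; 921;
  1445; -162; -382; 240; 1425; -515; -1890; 758; -289; 237; 119; -825; 1544; 993; 1240; 1615; -351; -435; -810; 402;
  1634; -1706; -1349; 838; -940; -1434; 871; 517; 1008; 1348; 1280; -1172; 1313; 787; -756; 202; 446; 1003; -391; -894;
  -73; -930; 12; 504; -1482; 2825; -1007; 1081; -108; -148]);
  (1394, [:: 368; -365; 168; 256; -506; -448; -386; 143; 328; -607; -181; 54; -40; -163; -131; -82; 161; -349; -393;
  -72; 207; -311; -106; 64; -332; -441; -71; -115; -402; 158; 3; -90; 299; -725; -618; -57; 447; 301; 412; -559; 129;
  104; -213; -191; -737; -351; 142; -248; 15; -252; 715; 110; 559; -329; 779; 632; 788; -29; -797; 5; 449; 415; 328;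
  1384; -108; -583; 121; 449; -38; 227; 913; 72; 206; -113; -19; 639; -658; 4], [:: -1874; -76; -895; -1018; 1839; -308;
  1123; -1029; -159; -125; -702; 1138; 1847; 1337; -301; 442; -1428; -2063; -991; -974; 237; 1673; 675; -1473; 268; 699;
  -858; 249; 1940; 139; 1014; 810; 571; -399; -816; 459; 1152; 457; -851; 9; 605; 1118; -49; 1960; -853; -468; 2163;
  1067; -848; -1898; -777; 1369; 308; 1304; 1030; -1471; -76; 126; -301; 9; 1247; 190; -1435; -1704; -300; -868; -1698;
  -1134; 353; 646; -37; 988; -205; 767; 556; 532; 1183; 768]);
  (1406, [:: -720; -645; 275; -36; -504; 27; 312; -277; 282; -413; 210; -129; -78; -634; -188; 525; -130; -844; 291;
  478; 25; 112; 628; -624; -186; -157; -483; 176; 362; 431; -243; 270; -1026; 266; -49; -238; -287; -126; -879; 263;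
  1039; -611; -3; -487; 540; -91; -533; 1024; -419; -512; 398; 102; -662; 423; -336; 591; 151; -643; 440; 1046; -191;
  386; 638; -232; 147; -759; 773; 196; -106; 1000; 313; 214; -612; -199; -184; 264; 619], [:: 1693; 659; -537; -1817;
  1257; 20; 749; -459; -8; -228; -286; -920; -1541; 631; -522; 702; 356; 967; 1658; -164; -1009; 634; -33; -480; -177;
  104; -379; 380; 741; -765; -631; -331; 339; 1906; -60; -1537; 244; 825; -1472; 478; 86; 736; -533; -93; 842; -822;
  154; 1152; 1211; -1127; -979; 567; -1584; 211; -734; -1433; -1063; -1590; -537; -1476; 993; -464; 18; -60; 393; 2;
  -1294; -239; 901; 893; -1605; 1406; -92; 414; -1291; 684; 1516]);
  (1456, [:: 343; -2; 653; -311; 772; 101; -116; 397; -3; -420; 197; -597; 382; 495; -374; 120; 949; 109; 73; 184; -104;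
  -266; 286; -26; -463; 6; -160; -255; -189; -295; 174; 127; 167; -558; 125; 292; 420; 398; -608; -131; -22; -224; -396;
  -474; 171; -121; -870; -251; -480; -437; -92; 884; -135; 606; -260; 340; 816; -1085; -690; -369; -319; -519; 313;
  -280; 165; -327; -968; 168; -733; 535; 118; -450; -435; -251; -112; -376], [:: -493; -944; -990; 1058; -567; 1454;
  -552; -141; 196; 101; 354; -41; 817; -1376; -319; -357; -814; 1330; -699; -1433; 1393; -120; -82; 740; -1207; -134;
  -148; 888; -88; -112; 697; -64; -359; 122; 4; -1032; 2273; -649; -932; 471; 1412; 1340; -762; 553; -144; -790; 564;
  -928; 334; -1356; 1061; -325; -795; -1052; -483; -2025; -625; -338; -705; 227; 1966; 0; -863; -1208; -6; -575; 891;
  1417; -586; -126; 1659; -1083; 1384; -882; 884; 1909]);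
  (1416, [:: -245; 171; -318; -488; -386; 148; 122; -183; 185; 361; 91; -306; -314; -341; 39; 28; 104; 1; -602; 357;
  304; -241; 117; 107; 676; 221; -242; 858; 503; -11; 22; 402; 226; -140; -108; 665; 136; -967; -49; 1133; 599; 115;
  -473; -539; 469; -1029; -679; 724; -228; 775; 463; 122; 167; 295; 480; 544; -723; -674; 198; -653; 459; -498; 411;
  331; 678; -31; -98; -328; 562; -304; -143; 387; 713; -63; -614], [:: 1816; 333; 866; 989; 291; 901; 430; 551; 259;
  -518; -82; 663; 121; 981; 283; 737; -614; 36; -158; -1313; -575; -405; 526; 237; 984; -88; -104; -926; -1394; -480;
  919; -590; -85; 803; 1662; -346; -1034; -626; 584; 539; -264; -1952; 82; -1738; 1178; 1241; 1556; -122; 1167; -1866;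
  -806; 281; -3; 1074; -523; 555; -2324; -652; 709; -1184; 1087; 709; -600; 1108; 593; -373; -171; -1555; -866; 1134;
  -583; -31; 201; -2027; 186]);
  (1418, [:: -449; -298; 625; 339; -535; -409; -384; 293; -624; -72; -273; 91; 442; -273; 144; 586; 44; 462; 307; -74;
  -645; -533; 67; -255; 661; 648; -467; -433; -160; -385; -709; -624; 394; -336; 807; -195; 940; 62; -844; -100; 587;
  -45; 562; -771; 111; 248; -722; 645; 499; -454; -461; -154; 544; 759; 155; 10; -123; -413; -65; -319; 351; -591; 96;
  -609; 103; 152; 2; 368; -310; 57; -333; -116; -776; 453], [:: 1108; 304; -1330; 433; 1463; -301; 419; 70; 486; -153;
  875; -692; -125; -971; -331; -1375; -381; 332; -1244; -539; -455; 722; 127; 1362; -558; 126; -200; -850; -177; 141;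
  685; -187; -2; 307; 33; 1370; -2011; -1092; 204; -1493; -1403; -1598; -839; 73; -950; 838; -179; -1334; 983; -1331;
  348; -330; 1816; 799; -515; -1023; 1066; -979; -1435; 1106; 695; 96; 114; 57; 1044; 288; -285; 223; 902; 856; 1859;
  -390; 157; -1168]);
  (1455, [:: 417; 144; -100; -692; 660; 15; -181; 613; -458; 105; 599; 32; -45; 630; 459; -44; -396; 351; -220; 442;
  -390; -323; 111; 60; -913; -407; -272; 443; 195; 333; 80; -805; -91; 106; 436; -268; 311; -243; -134; 134; -58; -24;
  -77; 539; -67; -50; -485; 12; -607; -801; -255; -63; -344; -433; -416; 312; 486; -479; -92; -483; 836; -468; 658;
  -117; 111; -798; -202; -233; 673; -411; -321; 960; -536], [:: -1677; -246; -836; 1230; -477; -559; -112; 509; 1423;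
  621; -707; -748; -1398; -1039; -778; -654; 1401; -364; -1762; -92; 340; -614; 192; -130; 670; 121; -296; 406; -521;
  -655; -924; 740; 301; -1348; -55; -867; 140; -161; -676; 392; -1997; 1766; 536; -53; -255; 1023; -458; -1796; -1251;
  1703; -1130; 347; -12; 953; 905; 558; 734; -1814; -933; 783; 1979; 539; 1095; -358; -861; 963; 129; -1032; 1451; 1059;
  657; 1773; -687]);
  (1477, [:: -336; -844; -532; -228; 258; -663; 105; 116; -225; -114; 191; -472; 452; -51; -368; -339; -252; -383; 374;
  435; 671; -512; 129; -150; -990; 342; -326; 608; -399; -107; -798; -500; -184; 534; 96; -274; 107; -90; 265; -591;
  200; -114; 138; -223; -419; -739; -337; -2; -349; 362; -612; 7; -392; -217; 926; 560; 641; 259; -303; 469; -564; -54;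
  733; -691; -115; -420; -355; 1185; -308; -719; 669; 422], [:: 1251; 1139; 597; 533; 428; 722; -47; -882; -104; 1002;
  -129; 156; -658; -537; 232; -1036; -38; -369; -360; 220; 217; 973; 294; 321; -1374; -1218; 20; 102; 720; -257; 758;
  632; 1339; -1395; 1184; 1854; 644; 1053; -2783; 1843; -1099; 765; -509; 1286; 325; -1112; 1656; 850; -770; -1209; 785;
  -19; -2268; -10; -400; 338; -716; -199; 1112; -1353; -1041; 427; 25; 498; 782; -1303; 176; -1127; 1721; -323; -429;
  -467]);
  (1486, [:: 956; -331; -62; -366; 168; 285; -159; 346; 158; 234; 274; 291; -136; 171; 329; -97; 112; 99; 111; -379;
  -81; 266; 142; 192; -739; 363; -639; 177; -313; 136; 58; -483; -670; 455; 708; -318; 270; 604; -273; 511; -413; -998;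
  862; -365; -51; 162; -953; 87; 450; 568; -303; 323; 241; -623; -793; 364; -714; 454; -281; -586; -407; -1239; -33;
  -366; -390; -326; 365; -463; 145; -270; -507], [:: -1482; 1438; 862; -276; -560; -1101; 57; -829; 807; 156; -442;
  -139; 215; 450; 582; -490; -147; 158; -654; 656; -428; -608; -1193; -324; 105; -789; 987; -1018; 215; -291; 1493; 269;
  -841; 2183; -335; 247; 970; -1459; 2144; 1034; 665; 302; 1071; 621; 2511; -1474; 1450; -1259; 511; 534; -1143; -869;
  234; 543; 787; -424; -88; 97; 399; 836; 63; 60; 560; 1429; 266; 1063; 148; -487; 1604; 315; -516]);
  (1521, [:: 691; -115; -590; 555; 197; -740; 168; 77; 846; 336; -164; 60; 88; 657; 671; 339; 134; -508; -411; -295;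
  -298; -40; 199; -249; 226; -279; 636; -98; -355; 94; -1020; 403; 681; 336; 147; 615; 68; -257; 1032; 66; 379; -222;
  431; 306; -81; -946; 53; 592; -104; -456; -871; 885; -1115; -535; 464; -488; -40; -265; 42; 710; -334; 764; -407; 264;
  240; -540; -268; 527; -1033; -404], [:: -1742; -342; 1755; 465; -71; 183; 977; 610; -998; 6; -760; 134; -575; -1439;
  557; 837; -220; 1796; 498; 1317; 1307; 2133; -1196; -857; -77; -957; -444; -350; 1075; -2620; 1346; -984; -1312; 677;
  122; -493; 353; 740; -1604; 450; 224; -492; -156; -10; 1944; 591; 1859; 187; 1158; 790; 735; -1084; -1808; 940; -814;
  -233; -444; -440; -565; -791; -1392; -823; 815; -228; -318; -614; 368; 728; -460; -306]);
  (1519, [:: -551; 235; 208; -155; -226; 347; -70; 413; 671; 107; -451; 88; 429; 493; -19; -193; 353; 509; 377; -192;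
  -115; 75; -185; 703; -144; -98; -357; 914; -229; -1270; 606; 7; -453; -403; 132; -178; 607; 416; -157; 580; -667; 813;
  -264; -866; 371; 15; 448; 211; 7; 217; 296; 9; -440; 936; 260; -866; -23; 336; 919; -209; 293; 872; 27; 527; -987;
  433; -139; 29; -508], [:: 1467; 227; -435; -657; 18; -311; -134; -434; -1130; 244; -358; 357; -253; -714; -904; 432;
  -201; -375; -322; -958; -252; 804; -93; -667; 1064; -744; -687; -781; 1819; 1246; 159; 443; -1211; 1067; -294; -918;
  151; 256; 1029; -2252; 1689; 1817; 230; -1021; -935; -1962; -2013; 162; -2184; -1572; -14; 333; -162; 610; 185; 2983;
  1317; -491; 485; 131; -593; 28; -430; -872; 1785; -360; -732; -316; 116]);
  (1529, [:: -663; 172; 376; 152; -253; 261; -36; -191; -221; 808; -259; 181; 729; 822; -332; -626; -879; 475; 726; 217;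
  142; -135; -547; 72; 107; 171; -708; 478; 509; -740; 71; 547; 517; -504; -378; -260; -723; 298; 475; 479; -801; 870;
  -322; 430; -467; -49; -597; -635; 419; 234; 305; 306; -76; 249; -295; -346; -136; 543; -10; -443; -581; 495; -451;
  361; -340; -326; -789; 173], [:: 1035; 690; -1501; 125; -441; -355; -52; -392; 423; -1361; -584; -879; -609; -344;
  -306; 587; 1023; 71; -335; 460; -685; -589; -35; 140; -451; -744; 48; 595; 235; -501; 733; -1971; 271; 846; -2135;
  -282; 609; -1093; -2104; 1577; 1548; 1213; 330; -276; 1190; -814; -1034; 73; -1958; -112; -1014; -755; 1806; 2112;
  1035; -290; -660; -206; -1029; 45; -1080; -998; 88; 996; 320; 1106; -368; -306]);
  (1533, [:: -679; 103; 45; 357; -88; -151; -97; -61; -129; 195; -347; -484; -304; 23; 537; -107; -382; -266; 403; -492;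
  864; 890; -67; -335; 366; 536; 541; -395; 623; 13; 177; -1084; -509; 41; -252; -578; 470; -724; 50; 279; -14; 166;
  -451; 416; -253; 851; 369; -389; -554; -309; 1218; -354; 247; 581; -226; -190; -439; -523; -678; 644; 283; -571; -130;
  80; -732; 1391; -30], [:: 1537; -454; 760; -124; 777; -207; 164; 475; -433; -655; -1066; 322; 83; 186; 682; 498; 169;
  -853; 657; 101; -471; -550; 267; -787; -2331; 1688; 46; -113; -1186; -839; -1682; 1174; -85; -301; 638; -2005; 203;
  -245; 1976; -2292; 173; 404; 438; -426; 1120; 471; 48; -39; -214; -315; -1946; -633; 977; -931; 182; -1554; -1718;
  -1510; -557; -131; -772; 831; 1590; 1440; 1898; -14; 649]);
  (1531, [:: -574; -386; 424; 133; -108; 148; -82; -213; 89; 563; 120; 256; 648; -72; -10; 587; 27; -71; 900; -560;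
  -850; 541; 448; -80; 150; -25; -512; -123; 228; -247; -289; -283; -442; 565; 619; 151; 46; -470; -120; -839; -547;
  -241; -460; 348; 869; 779; 692; -91; -673; -889; 424; 0; -577; 944; 708; -374; 151; 886; -894; -26; -634; 300; -59;
  489; -91; 799], [:: 1347; 303; -958; 168; 296; -38; 419; -651; -540; -1083; -307; -760; -1245; -462; -635; -310; 487;
  -98; -903; 1596; 1636; -86; 735; -832; 616; 125; -1370; -1353; -923; 415; -200; -218; -936; 200; -459; 889; 841; -323;
  354; 162; -143; 753; -1512; 1111; 53; -440; 829; -1124; 739; -1228; 596; 970; 371; -1656; -2101; -2008; 1137; 800;
  304; -641; -1043; 1612; 2332; 1424; 423; 1786]);
  (1598, [:: 956; 202; -426; -549; 598; -280; -330; 591; -912; -189; 552; -284; -161; -508; 273; -193; -209; 478; 136;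
  -336; -313; -228; 127; -543; 618; -245; -472; 267; 186; -93; 174; 1380; -119; -127; 57; -190; -141; 397; 1248; -231;
  495; 447; -244; -584; 103; -732; 616; -133; 120; -527; -19; 128; -11; -570; 583; -883; -1198; -360; -293; -1056; -599;
  -569; -442; -707; -371], [:: -1536; -663; 932; 508; 859; -836; 780; -232; 352; 104; -885; 189; -801; -448; -218; 530;
  -1100; 207; 143; 592; -1411; 474; 137; 400; -800; 444; 401; -845; 1414; -1483; 968; 1185; -135; 508; 1253; -217; 529;
  236; -1153; -47; -652; -2225; -301; 1798; 934; -889; -1393; 1258; -1266; 988; 665; 1531; 188; -634; -1363; 336; 2487;
  -256; 909; 624; -193; -629; -40; 909; 103]);
  (1615, [:: -817; -598; -226; 622; 26; -115; 177; -246; -390; 395; -677; -53; -142; 650; 178; -642; 841; -320; -541;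
  -861; 156; 20; -528; 110; 204; -200; 7; -421; 778; 316; 635; 685; 546; -46; 26; 521; 235; 221; -496; -226; 538; -988;
  72; 693; -280; 474; 156; 517; -476; 36; -810; -694; -1111; 64; 240; -1012; 666; 12; -286; 156; -1092; -985; -955;
  -36], [:: 1910; 75; 27; -1348; -339; -1102; 793; 520; 437; -590; 521; 1983; 371; -404; 595; 1139; -1357; 380; 345; 68;
  -883; -941; 709; -565; 678; -103; 825; 894; 1298; -1074; -1305; -326; -1897; -541; 894; -374; -587; 1347; 2086; 1157;
  1326; -491; -663; -2179; 2195; -1405; -765; -215; -582; -1774; 181; 588; -864; 832; 510; -739; 1035; -1335; 224; 738;
  -271; 1608; 1165; 156]);
  (1649, [:: 936; -439; 394; 157; -624; 158; 109; -59; -582; 768; -244; -667; -419; -613; 715; -190; 310; -194; 101; 34;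
  130; 561; 8; -340; -659; 371; -300; -686; -482; -254; -597; 97; 1365; 135; 206; 539; 225; -255; 522; -1010; 56; 588;
  -502; 0; -651; 240; -1071; 1168; -8; 736; 535; -35; 95; 39; -463; 155; -319; -245; 280; 826; 895; 399; -303], [::
  -1244; 358; -1280; -68; 149; 684; 342; 81; -252; -22; 1035; -542; 297; 261; -101; -1114; -65; 640; -1072; -105; -541;
  -1099; 168; 796; 726; -426; 679; 526; -615; -229; 395; -322; -804; -1166; 1808; -2234; 1490; 1626; -201; 2356; -243;
  -2382; -2005; 597; -1688; -219; 1430; -2290; -171; 1649; -1092; -1321; 1704; -679; 172; 802; 853; 1087; -1007; -507;
  420; 59; 89]);
  (1676, [:: -705; -376; 538; 146; 9; 320; 255; -264; 111; -604; -602; -253; -400; 39; -333; -57; 131; -276; -331; 370;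
  -297; 632; 390; -356; -839; -98; -742; -467; -384; -862; 590; -120; 668; 724; 738; 207; 43; 844; -12; 250; 635; 122;
  1157; -229; 1002; -1439; -172; -590; -751; -593; -234; -681; 540; 1014; -605; 230; -298; 246; 858; 240; 844; -171],
  [:: 1367; 1771; -725; -285; 433; 73; -536; 152; 649; 711; 1292; 414; 417; 283; -943; -903; -1048; -139; 646; -536;
  403; -879; 722; 942; 1309; 675; -1208; 565; -147; -1177; -2555; 2406; 1145; -1246; 123; -1055; -1228; 1677; -391;
  1167; 26; -275; -1180; -604; 503; -1282; 1584; -114; -1525; -344; -1003; -415; -372; -1036; -152; 583; -157; 1111; 34;
  -763; 305; 870]);
  (1699, [:: -614; -313; 594; -523; 277; 423; 321; -530; -99; 0; -395; 525; 615; -290; 93; 960; -584; -383; -348; -185;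
  -44; -493; 522; 707; -563; 547; -182; 330; 402; 467; -449; -213; -879; 487; -158; -49; 97; -655; -436; 789; -1313;
  -1133; -224; -877; 209; 434; 869; 28; -400; 96; 29; -462; 176; 111; -866; 1400; 110; -214; -746; -282; 164], [:: 2173;
  762; 411; 787; -81; -759; -39; 450; -342; -471; -171; 51; -1081; -924; 699; -918; -331; -815; -506; 178; -114; 729;
  330; -762; 11; -836; 1719; 782; -1387; -571; -24; 1154; -213; 849; -100; -120; 1549; 1279; 1311; -1310; -1441; -508;
  -858; 1749; -559; 954; 164; 154; 349; 351; -1303; 1918; -777; -2423; 59; -753; -1577; 949; -278; 950; 151]);
  (1726, [:: 504; -650; 819; -146; 549; -515; -92; 123; 230; 716; -358; -503; 343; 223; -489; 139; 785; 371; 761; -87;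
  -148; -379; -185; 11; -35; -101; 551; -54; 523; -23; -235; 1104; -852; 613; -916; -333; 156; 397; 650; 551; -271;
  -364; 1016; 489; 692; 611; 225; 999; -339; 734; -39; -107; 619; 1117; -38; -439; -1157; 938; -1261; -461], [:: -1182;
  1452; -667; -669; -23; 913; 921; -375; 90; -556; -731; -469; -628; 67; -169; -41; -1369; -98; 218; -953; 572; 323;
  151; -587; -1235; 2841; -444; -1293; 287; 2249; -184; -1496; -1443; -1745; -107; 2240; 1746; 258; 468; 1161; -297;
  1174; -219; -1602; -309; 809; -648; -1424; 580; -989; 659; -1216; -127; -1234; 1079; -1319; 350; -1165; 331; 819]);
  (1746, [:: -673; 75; 428; 382; -373; 68; -473; 511; 177; -383; -179; -511; -93; -690; -458; 7; -393; -685; -210; 469;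
  215; 670; -703; -439; -297; -40; -245; 303; 270; -440; 755; -832; -96; -1056; 127; 484; -363; 238; 294; 664; 462;
  1332; -519; -264; -632; -17; -402; -559; 1121; -441; 647; -697; -294; -594; 172; -1418; 1040; -218; -1232], [:: 723;
  1382; -579; -358; 123; 541; 316; -973; 464; 907; 592; 1218; 78; 42; 1206; 995; -846; 106; 1558; -216; -664; -857;
  -515; -198; -145; -86; 464; -598; -1626; 693; -203; 282; 2144; -146; -2476; -324; 743; -583; -389; 127; 58; -261;
  -1078; -185; 561; 990; -2; 108; -2286; -1016; 1058; 330; 362; -1356; -867; -777; -556; 651; -2185]);
  (1761, [:: -929; 477; 626; 734; -412; -272; 46; 277; 780; -342; 41; -740; -11; 458; -228; -474; -423; -574; -197; 437;
  -182; 593; 544; 247; -896; 746; 600; 583; 419; 41; 246; 616; 712; 417; -958; 669; -566; 109; -617; -433; 21; 125;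
  -1319; 317; -452; -1057; 1178; -1134; 611; -174; 472; -306; -605; 1004; -2; -109; 412; 942], [:: 1777; -107; 116;
  -741; 992; -666; -1264; -1668; 33; -428; -103; 1077; -469; 17; -775; -1164; 1188; 1569; 35; -402; -542; 139; 143; 281;
  64; 262; 915; -269; 1021; -1254; -1744; -85; 1049; -178; -160; -304; 992; -1520; -1052; 1340; 315; 772; 216; -1085;
  470; -1204; -2116; -1009; -1833; 251; 2486; 1335; 615; -2032; -236; -1212; -399; -978]);
  (1778, [:: -723; 376; -477; -243; -109; 20; 396; -526; -522; 515; 491; 421; -84; 521; 860; 410; 245; 49; -739; 119;
  -212; -696; -772; 1156; -930; -707; -99; 245; -23; -306; 118; -403; -824; 936; 186; -526; -315; 809; -660; -1361; 139;
  642; -259; 619; 1048; -190; -157; -638; 559; 287; 528; 619; -89; -478; -601; 230; 169], [:: 1277; -984; -318; 811;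
  541; -643; -291; 790; 195; -810; 619; -447; 21; -258; -1147; 716; 1270; 804; -559; -148; 235; 1442; -243; -1262; -726;
  859; -804; 416; 30; -1093; 1253; 1181; -1103; -698; 1292; 830; 189; -2010; 273; 1734; 375; 1226; -2419; -1269; 117;
  -166; 1113; -1525; -707; 1740; 1233; -2462; -1737; -971; 219; -1245; -55]);
  (1779, [:: 380; 570; 609; -79; -278; -393; 628; 688; -449; -339; 266; -116; -482; -705; 431; -31; -704; 377; -327;
  -78; 610; 475; -370; 373; 300; 363; 85; 333; 83; -733; -1051; 692; -80; 430; -249; -8; -405; 140; -180; 275; 735;
  -159; 467; -762; 146; -227; 927; 910; -697; 444; -950; -564; -939; 393; 346; 326], [:: -1410; -925; -826; -109; 277;
  441; 37; 234; -334; 370; -699; -1091; -124; 60; 634; 1189; 27; -1193; -309; 1416; -76; -441; 814; -218; -634; 786;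
  884; -586; -550; 784; 601; -1758; -712; -2286; -343; 2676; -1409; 1332; 1833; -573; -1454; -599; -2119; 1808; -552;
  1021; 90; -905; -122; -1186; 21; -1631; -2061; 287; -1303; 1145]);
  (1822, [:: 677; -138; -553; -281; 813; 590; 272; -355; -277; 141; 49; -784; -79; -57; -47; 87; 115; -429; 95; 187;
  711; 9; -122; -438; 506; 1094; 498; -701; 690; -1050; -893; -737; 593; 275; 711; -452; -288; -737; -1209; 1360; -595;
  -622; 692; -68; -812; -400; -217; -1342; 131; 186; -487; -755; 898; 782; -771], [:: -1057; 638; 263; -64; -756; 477;
  -208; 635; 493; 102; -577; -360; 123; 131; -316; -361; -553; -1; 887; -262; 689; 25; 1954; -1616; -483; -895; 1244;
  355; -185; 773; -160; 323; 1352; -1366; -111; 1968; 1040; -1355; 1217; 230; 25; -1168; 1379; 82; 517; 2188; 1209; 376;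
  1624; 808; 1557; 1262; -352; 1563; 1453]);
  (1867, [:: -664; -859; -523; 246; 915; 512; 458; -18; -130; -1048; -536; -853; -635; 882; -491; -253; 346; 62; 692;
  553; 212; -298; 367; 734; 198; 656; 830; -82; -1246; -726; -140; 909; -870; 597; -79; -851; 154; -2; -266; 644; -1404;
  113; 539; 534; 416; -183; -491; -484; -385; -902; -19; -105; 1861; 578], [:: 313; 498; 1159; 546; -1181; 90; -54;
  -604; 721; 656; 97; 1243; -16; -971; 133; 1027; -663; -1292; -865; 920; -207; -319; 455; -1139; -1952; -606; -466;
  140; -555; 1018; -660; 1401; -240; -657; -1022; 926; 1132; -948; -1944; -1634; 1095; 16; 2105; 1310; -1247; -162; 790;
  -1051; -226; -486; 650; -603; -1211; 125]);
  (1914, [:: 493; -635; -354; -578; 736; -71; 109; 222; -34; 625; 216; 374; -16; -870; -219; -664; 772; 818; 2; -3;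
  -369; 583; 392; -612; -1382; -798; -972; -503; -284; -1093; -1037; -88; 752; -327; 880; -335; 110; -353; 311; 53;
  -129; 908; -768; -638; 1071; -1022; 311; -138; 757; 513; 34; 191; -607], [:: -988; 785; -445; 479; -1397; -574; -1067;
  184; 365; -212; 279; 394; 337; 1113; 1330; 783; -1853; -443; 832; 425; -149; -1040; 390; 153; 1038; 776; 1072; 665;
  -154; 229; 920; 1267; -585; 1102; 203; 758; -1625; 904; -2219; 1807; -796; 2831; -1672; -766; -1657; -704; 262; 171;
  869; 1262; -1544; -813; -67]);
  (1975, [:: 851; -645; 277; -69; -60; 265; 608; 330; 296; 546; 349; -367; -806; -111; -555; -114; -433; -273; 493;
  1193; -721; 240; -1335; -1297; -1071; -555; 972; -252; -1196; 287; -994; -587; -266; 440; 605; -457; 9; 1045; -64;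
  -885; -97; -476; 382; 400; -141; -1090; 0; 115; 1046; 943; -544; 1126], [:: -603; 1446; 1077; 1362; -117; 7; -674;
  -825; -676; -1380; -716; -327; 862; -861; -89; 745; -307; -157; -1175; -1579; 1033; -1623; 198; -1960; 1682; -692;
  1338; -254; 225; 1325; -1984; 613; 979; -385; 616; -966; -1979; 1391; 579; 341; 51; 295; -1345; 2368; 1822; 1137; -2;
  703; -972; -876; -163; 109]);
  (1987, [:: 638; 683; -740; 437; 250; -600; 507; -108; -546; 61; -152; 445; -37; -436; -296; -968; -854; -144; 614;
  -62; 447; 34; -270; -254; -15; 1420; -23; 228; 94; 22; -265; -645; 85; -782; -1101; 707; 844; 1165; -714; 347; 1053;
  552; 569; 1278; -1590; 245; -689; -1230; -25; 246; 293], [:: -629; -1830; 130; -676; -1069; -292; 913; 660; 973; 249;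
  -1; 165; 764; -27; -1189; 632; 1045; 1191; 752; 53; 1547; 388; 616; 444; 1159; -62; -26; 1701; -703; -182; -492; 961;
  -172; 278; -2058; 1452; -2893; -94; 66; -483; 1654; -1322; 171; 89; 570; 1125; -52; 2228; 1829; 543; 919]);
  (2014, [:: -190; -782; 800; -633; -337; 1086; -80; 645; 681; -688; 837; 124; -724; 394; -209; 69; -945; 123; -111;
  -512; -5; 959; 448; 731; -345; 479; 376; -693; -159; 986; 1; -46; -1416; 627; 609; 935; -861; -575; -390; 387; -1276;
  127; 641; -607; 429; 1073; -393; -79; 769; 597], [:: 1323; 1032; -205; -629; 599; -1397; 1000; -446; -1304; 36; -67;
  -1412; 600; 364; -14; -1586; 461; 778; -154; -1641; 210; -1133; 518; -2035; 514; -310; 1174; 1292; 277; 319; -2093;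
  -1693; -1061; -390; -2202; -120; 90; 1588; 303; -564; 420; -596; -1823; 554; 1094; -428; -1202; -272; -1405; 354]);
  (2086, [:: -760; 87; -453; -428; 265; -389; -439; 62; 686; 615; 618; -685; -275; -78; 23; -30; 485; 259; -102; -351;
  -744; 324; 599; 630; -1000; 308; 334; 103; -171; -93; -1471; 370; 779; 783; -443; 1840; -495; 1353; 968; 2038; -1634;
  226; -1174; -1315; -1421; -26; -1145; 1246; -13], [:: 628; 359; -194; 337; -229; 509; 86; -1320; -681; 819; -669;
  1060; 386; -992; -1293; -218; -151; -402; -1056; 105; 875; 271; -983; 782; -1066; 1200; 265; 1272; -599; 453; 103;
  562; 633; -809; -512; -521; -1073; -966; -2043; -1226; -310; -1328; 1718; -2269; -327; -2759; -738; 1557; 545]);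
  (2145, [:: -595; 1259; 393; -691; -845; -489; 812; 418; -580; -424; 23; -677; 481; 963; 836; 203; 494; 1119; -198;
  532; 238; 286; 557; -156; 597; -1008; -43; -200; 89; 895; 260; -1349; 688; 423; 360; 1418; 709; -519; -1361; -204;
  -1081; 1248; 1052; 1122; 157; -318; 176; -129], [:: 1276; -1117; -170; 1032; 1052; -644; 93; 772; 1153; -804; 799;
  880; 214; -460; -752; -1370; 987; -1225; 35; -2409; 1705; -1601; -869; -1845; -500; 1377; 1588; 355; 1153; -271;
  -2132; 756; 54; -2305; 551; -618; -1273; -146; 239; -980; 153; 512; 210; -987; -462; 2225; 2108; 1027]);
  (2185, [:: 385; -666; -26; 1556; 663; -824; -148; 62; -1088; 177; 762; -100; -179; -467; 290; 513; -54; -777; 840;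
  -639; -36; -282; 707; -880; -214; -494; -445; -1142; 249; -935; -550; 476; -532; -1350; 721; 481; 207; 1564; 841; 774;
  39; -532; 401; -1001; -1429; 179; 936], [:: -969; 275; 1061; -229; -530; 784; 345; -462; 380; -634; -282; 143; -404;
  -61; 225; -330; 25; -103; 1378; 2145; -1373; 871; -2379; -1762; 894; -1238; 2286; -241; 1159; -139; -490; -994; -222;
  -407; -1335; -1714; 844; 1387; -951; -894; 1307; 379; 779; -448; -307; 1245; -1922]);
  (2238, [:: -753; 634; 1070; 581; -109; 610; -139; -326; -46; -716; 748; 745; 282; -294; -692; -427; 317; 956; -716;
  -277; 1725; 738; 374; 297; 200; 211; -1192; -70; -218; -990; -717; 1179; 799; -614; 38; 1902; -47; 472; -542; 857;
  -573; 1561; 714; -1511; 1819; -18], [:: 773; -803; -1046; 113; -704; -780; -58; -345; -171; 990; -305; -842; 928;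
  1333; -469; 757; -777; -286; 548; -74; -1170; -532; 22; -318; -1035; -1815; -997; 1068; 1581; 1184; 781; 12; -1145;
  409; 907; -2747; 527; 1167; 866; -1314; 1411; 1402; -1212; -23; -1613; -1696]);
  (2292, [:: -1167; -186; -841; 718; 285; 92; 527; 9; 145; -22; 512; 895; -225; -133; 687; 41; -824; 361; -44; 904; -75;
  650; -414; 1289; -1641; -947; 447; 1258; 997; 351; -879; -716; -979; 746; -1826; -1272; 1452; 781; 53; -276; -495;
  911; -359; -753; -472], [:: 959; 987; 854; -860; -851; -322; -1337; 54; -89; 706; -1505; -74; 2355; -952; -889; -712;
  -581; -256; 438; -170; 871; 1049; 694; 143; 1267; -54; 814; 23; -1664; 1285; 1123; 828; -2297; -2351; 192; 1479; 1978;
  -1606; -628; -142; 980; -720; -1155; -596; -1439]);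
  (2407, [:: -543; 986; -530; -66; -19; 439; -739; 734; -784; -288; 18; 521; -260; 30; 1119; 1070; 391; -447; -949;
  1253; -1431; -533; 70; 894; -1300; -1301; -856; 701; -104; -417; 818; 255; -943; 1252; -899; 119; -1984; -471; -611;
  1063; 1465; -300; -689; 1496], [:: 1233; -450; 206; 438; 80; 68; 829; -1158; 841; 822; -743; -1049; 85; 160; -789;
  -851; -193; 2424; -471; -509; -274; 941; 932; -328; 1568; -800; 1221; 275; -881; -919; -130; -211; -1434; 1591; 799;
  939; -1031; -1998; 176; 759; -580; -1232; 2563; -1413]);
  (2441, [:: 1270; 152; -1028; -695; -694; 1167; 616; 433; 628; -785; 285; 349; 795; -876; 493; -585; -1212; 163; -474;
  533; 317; -244; -1534; -1017; -1091; -1202; -896; -938; 1573; -561; -673; 765; -335; 144; -1461; 78; 871; 129; -1163;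
  70; -854; -811; -1506], [:: -1044; -479; 762; -267; 953; 532; -529; -937; -961; -104; -1400; -1198; -1070; -1421;
  -276; 203; -8; -1063; 1305; -1009; -1067; 803; 888; 1042; 376; 704; 1198; 700; -1548; -283; 1436; -1328; 274; -879;
  1823; -2015; -373; 120; -2020; 1660; 895; 682; 1266]);
  (2580, [:: 539; 170; 209; 387; -378; 33; -1005; 29; -581; 283; -392; 734; -1234; 118; 526; 3; -1312; -928; -1528;
  -638; -141; -1282; -841; -358; -315; -910; -1251; 1621; 698; 935; -1383; -222; -47; 440; 540; 1071; -1133; 2028; -275;
  -1510; -614; -191], [:: -1242; -1311; 282; -132; -392; 657; 388; -337; 1373; 701; 4; 28; 1460; -1139; -258; 426; 1149;
  -1385; 1666; -1445; 1662; -710; -1552; 2041; -428; 127; -647; 1293; 2333; -1823; 1749; 470; 1128; 103; 338; -254; 409;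
  -224; 1009; 1581; 371; 1308]);
  (2588, [:: -636; 304; 558; 247; 100; 307; 442; -1132; -194; 162; -604; 422; -3; -913; 582; 341; -732; 229; -1201;
  -228; -830; 793; -1358; 1355; -1328; 1127; 1626; 1819; 645; -920; 55; -981; 338; 1946; -1093; -976; -1108; 2194;
  -1585; -261; 540], [:: 797; -922; 8; -1563; -458; -974; 991; 60; 716; -960; 745; 40; 343; 624; -305; 108; 957; -1737;
  78; -1459; -462; -203; -827; -394; 755; 1454; -1398; 786; -715; 682; 1444; -1608; 1622; -275; -846; -1406; 477; -630;
  207; 2531; -2220]);
  (2702, [:: 1392; 847; -853; 222; -116; -311; 1100; -1288; 464; 291; -484; -431; 1477; 1888; -446; -1056; 339; 976;
  734; -519; -2297; 1404; 356; -762; -1629; -86; -327; 645; -1717; 1448; 1760; 637; -870; -748; -331; -568; 245; -1280;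
  -632; 1069], [:: -1614; -809; 403; -156; 698; -148; -915; 1152; -1290; -570; 512; -773; -670; -661; -844; -592; -88;
  -1477; -1521; 1329; 655; -1328; 752; 1999; -766; -886; 1797; 2624; -550; 412; -204; -228; 162; -149; -10; -1939; 1252;
  -1467; 810; -1260]);
  (2812, [:: 975; -41; 95; 90; -802; -1171; -570; -815; 413; 806; 597; 67; 1974; 520; -1054; 1230; -431; 1057; 621;
  -188; -412; 8; 888; -1409; 662; -2045; 1621; -111; 38; 2059; 1823; -717; -1573; -2183; 285; 358; -466; -1188; 160],
  [:: -260; -164; 346; -62; 1118; 756; -1091; 1882; 166; -548; 697; 1603; -121; 778; 1989; -1515; 1858; 1166; 117; 589;
  1282; 1161; -146; 677; 287; 1029; 397; -772; -712; -1080; -1003; 1732; -2151; 448; 460; -842; 283; 187; 2840]);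
  (2891, [:: -1829; 360; 905; 577; 950; 151; -342; 333; 479; -1342; -21; 759; 1298; -1242; 392; 832; 1942; -1287; 520;
  530; -756; 1857; 1112; 555; 304; 569; -1805; 439; -1645; 1685; -927; 889; -1820; 159; -806; -60; 641; 2211], [:: 1052;
  350; -1605; -179; -554; -1253; 560; -1153; -1855; 1357; -669; 600; -1002; 395; -570; -385; -784; 1511; -1851; -747;
  586; -545; 729; -2060; -909; -1951; 1168; -463; 1092; -474; 1089; 1846; 1937; 641; -219; 940; 574; 991]);
  (3001, [:: -1445; 449; 492; 57; -304; -341; -539; -533; 109; 288; 676; 186; -457; -1397; -1532; -1090; 778; -404;
  -2035; 328; -2360; -1269; -108; -682; -546; 1479; 1099; -709; 1710; 2042; -79; -302; -2055; -814; 1112; -968; 467],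
  [:: 1780; 457; -944; -798; 455; 697; 135; 355; -935; 97; -745; -908; 333; 746; -1232; 515; -74; 140; 423; 604; -1308;
  334; -1449; -749; -376; 2117; 962; -500; -1581; -264; 2511; 2906; 1700; -2002; -2229; 1346; 1612]);
  (3160, [:: -1566; -543; -52; 826; -316; 1320; -664; 971; -794; -754; -2038; -402; -1228; 748; 1644; 373; 1232; 1626;
  -750; 2494; -819; 206; 1721; -870; 865; 809; -245; 342; 248; 185; 2055; -1114; 1421; -1887; -575; 76], [:: 834; -1361;
  254; 472; 240; -767; 17; -1232; 1413; -1017; 483; -8; 433; -1196; -1366; -2236; 1374; -1223; 1372; -1742; 1595; 248;
  -1560; -1057; 2038; -136; 609; -2048; 1355; 249; -620; -730; -1660; -418; 639; 1326]);
  (3312, [:: 1723; -253; -1113; -183; -1132; 1235; 528; 101; 467; 89; -109; -464; 374; 1549; -1931; 765; 235; 1617;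
  -418; -3; 2952; 781; 41; 1191; -1123; 278; -649; -1414; -1269; -2852; -1034; -1122; 1569; 1143; 455], [:: -1365; 1203;
  1070; -274; 756; 662; -827; 281; -803; 409; -1780; 1664; -444; 829; -617; -249; -1686; 1248; -2568; -975; 2529; -982;
  -259; -1020; 1558; -1030; 894; 1900; -485; -1620; 726; 1160; -4; 1871; 1115]);
  (3447, [:: 949; 868; -696; -114; -51; -508; 319; -1201; -84; -1295; -30; -1307; 1939; -2811; 140; 1564; -1135; -613;
  -2028; -365; -424; -2677; 2177; 539; 379; -745; 2059; 1571; -705; 63; 895; -130; 1196; 1295], [:: -1401; -1885; 1330;
  448; -297; 363; -960; 1596; 1395; -82; 279; 1451; -1563; -1183; 423; 656; 913; -458; 1647; 886; 1381; 1208; -1057;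
  -1383; -1425; -2643; -998; 470; 385; 262; 1048; 1021; -77; -1173]);
  (3523, [:: -244; -776; -453; -1223; -726; -772; -1492; -104; -921; 368; 861; 1004; 879; 1261; -1019; 1031; -1629;
  1024; -2188; -2470; -1638; 916; 1754; -871; -1609; 225; 2821; 34; 451; 13; -651; -2054; 3346], [:: 1364; 88; -308;
  845; -412; 1572; 223; 980; -393; -1091; -966; -47; -197; -633; 152; -1377; 1324; -886; 1024; -1317; -918; -814; -112;
  -1779; -167; -1351; -2354; 161; 1316; 832; -1009; 777; 2384]);
  (3633, [:: 1371; 207; 1054; -1231; -739; 226; 1215; -70; -971; -2757; -1364; -1877; 1617; -994; -3092; 2990; -3001;
  1927; -897; -459; -471; 1236; 2465; 657; -625; 2232; 1482; 424; 1566; 1955; 143; 907], [:: -1611; 1110; 187; 1146;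
  -638; -677; -446; 413; 446; 284; 1534; 1765; -1889; -1814; 228; 1425; 129; 594; -828; -317; 1183; 1662; -1534; -437;
  -247; -1803; 402; -767; 1660; -1380; -794; -1101]);
  (3879, [:: 1412; -13; -613; 457; 724; -995; 411; -853; -1813; -402; 85; 97; -1190; -798; -757; 808; 632; -489; -1803;
  -3076; -1435; 2132; 851; -2195; 2380; -284; -2248; 2175; -1047; 1991; -2705], [:: -1529; -602; 93; 166; 334; 1153;
  -729; 793; -48; -1419; -573; -119; 1074; 1306; 252; 1427; 2176; -208; 997; 1021; 190; -126; 815; 420; -623; 596; 2993;
  -2337; 1684; -847; 2589]);
  (4056, [:: -2337; -129; -65; 718; -386; -1852; -755; -69; -728; -594; -1265; -61; -106; 1527; 561; -2256; -1717;
  -2165; -1841; -2484; -2435; -1484; -3334; 132; 2177; -1823; -337; -3463; 1681; 490], [:: 1906; -388; 111; -1213; -158;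
  1054; -349; -256; 1234; 582; -2014; -667; 615; 407; -1087; 1114; -1446; 1473; 396; -1172; 351; 171; -1253; 428; -1853;
  1679; 1449; -1493; 1519; -2732]);
  (4233, [:: 1740; -568; 1330; 39; -96; 649; 1539; -68; -868; -1236; 474; -1561; 2318; 1936; 1923; -741; 1893; 1692;
  3041; -672; 1097; 1128; 941; -3594; -1280; 3054; 2597; 1252; -2592], [:: -1699; 1526; -1505; 171; 247; -1211; -617;
  -185; 838; 427; 502; 559; -273; -2174; 1633; 288; -745; 1971; -2737; -638; 526; -2995; 2344; 60; -663; -518; 253; 473;
  321]);
  (4480, [:: 1855; 446; -1958; -529; 516; 2766; -1446; 286; -2544; 2357; 2815; -2002; 210; 2611; 390; -821; 3128; -485;
  -3720; 1419; -1422; 1984; 214; -25; 3359; 1505; -2408; -218], [:: -1396; 894; 735; -155; 799; -44; 94; 755; -999;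
  -1661; -507; 315; 2477; -1106; 1371; -1009; 85; -136; -440; 994; -98; -302; -639; 1320; 2201; -1544; -2177; 866]);
  (4605, [:: 1294; -1324; 542; 1485; 1302; 441; 237; -2238; -260; 2355; 530; -3874; -517; 3639; -632; -1735; -3736;
  -1945; -1810; 634; 2187; 474; -619; 383; 3428; 1459; 1382], [:: -1261; 965; -622; -1733; 920; -986; 78; 935; 1644;
  -788; -1338; 428; 1524; -2998; -952; 2018; -1261; -872; 1238; 403; -701; 833; -749; 297; -560; 2086; -1515]);
  (4864, [:: 1818; 889; -482; 484; -691; 1607; -1471; -132; 1194; 3870; 170; 2858; -1331; 3245; 889; -2630; 1956; -2543;
  1631; 1044; 2476; -3983; -435; -580; 4004; 322], [:: -819; -644; -16; -686; -149; -1590; 1534; 1047; 385; -410; -285;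
  -1329; -270; -1048; -583; 1694; -524; -1342; -1382; -2025; -1406; 754; 1859; 1560; -2353; -247]);
  (5137, [:: 2865; 1584; -1050; 717; -455; 1230; -2172; 514; -16; -1090; -356; -2430; 4416; -4; 3378; -1485; 1520;
  -1871; -2123; 3676; -2521; -1822; 296; 2310; -2092], [:: -1646; -559; 410; -1314; -772; -477; 524; -888; -1308; 238;
  1806; 810; 1299; 2605; 95; 1629; -540; 55; -558; -1543; -973; 121; -2174; 1815; 1988]);
  (5432, [:: -1020; -1575; -1149; -357; -769; 1773; 2640; -3395; -154; 373; 2869; 4312; 1694; 2700; 1387; -361; -3168;
  2194; -391; -1091; -3981; 43; 5275; 940], [:: 1112; -95; 1655; 1475; -360; -249; 270; 2063; -142; -2032; 46; -38; 49;
  -1695; -2636; -1313; 865; 1545; -372; 1553; 1857; 1171; 1350; 59]);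
  (5519, [:: 3853; -844; 2707; 996; -666; -2095; 1209; -1743; -4386; -3362; 3037; -3216; -1559; -3151; -310; 1229; 606;
  -1837; -1718; 4118; -1334; -301; 3177], [:: -1622; 477; -1265; 495; -565; 2199; 800; -1310; 402; 587; -1450; 578;
  2450; 606; -1827; 1259; 1741; 1414; 2874; 812; -535; 608; -1150]);
  (6087, [:: -2281; 1649; -753; 920; 958; 1396; -151; 86; -623; -34; -3310; 3028; -506; -2324; 3061; 3308; -2198; -5157;
  -254; -4621; -2873; -84], [:: 1594; 1149; -375; -111; -1747; -639; 1834; -617; 1077; 2309; 962; -200; -1484; -1359;
  -1278; -2264; 288; 94; -2336; 1771; 1444; -202]);
  (6239, [:: -3179; -38; 881; 1673; -2099; 2010; 740; 483; -3686; -1574; 727; 1311; 4283; 3682; -3846; 4619; -366; 4808;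
  3337; 3344; 25], [:: 2227; -1202; 413; -1441; 2200; -613; -2584; 1350; 1793; 1905; 1888; -2142; 772; -483; 690; -558;
  522; -650; -600; -1743; -2177]);
  (7031, [:: 4582; -4219; -2505; 1274; -4380; -225; -851; 1185; 3125; -3010; -3636; -6981; 1481; -2245; 267; 687; 799;
  -6080; 1303; -1970], [:: -2539; 183; 319; 1244; 960; 934; 1538; 738; -172; 467; -1990; 1708; -1349; 1890; -2046;
  -2382; 1258; 169; 705; -2056]);
  (7425, [:: -5298; -1698; 560; -1103; 2506; -4267; -4891; -689; 1536; -6765; -133; -575; 164; 1426; 4180; -755; -7417;
  3744; 1379], [:: 1450; 310; -173; -1059; -2532; -163; 505; -599; -2445; 1444; 707; -1378; -1874; 2023; 1329; 1090;
  -747; 30; -787]);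
  (7512, [:: -1721; 115; 3307; 1498; 3745; 183; -257; 3924; -1060; -979; -5039; -1743; 480; -2717; 4109; 3586; -7499;
  3970], [:: 1269; 811; -1719; -394; -1211; -181; -37; 754; 407; 2656; -2710; -1245; 567; -681; -285; -2341; 2348;
  274]);
  (8201, [:: -5977; 3053; -1390; -860; -713; -1590; 1687; -1197; -1189; 8143; 2751; 6640; 2883; -5660; 4013; -1711;
  -4880], [:: 1349; -1256; 594; -660; 788; 395; 974; 2343; -365; -2496; 1648; 2219; -1996; 417; 370; -370; -344]);
  (9184, [:: -3254; 3712; -1228; -1366; 2605; -5451; -3794; 2998; 25; -1968; -8582; -5651; -5641; 1120; -1908; -706],
  [:: 434; -1870; 1104; 2010; -757; 921; -25; 1259; 97; 2997; 2772; 481; 840; 159; 653; 1491]);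
  (9347, [:: -1879; -4863; 3216; -5512; 7328; 1051; -1860; -1028; -5800; 1480; 6384; -1303; 8372; 2763; 4958], [:: 1355;
  1336; 1127; 913; -563; -2447; -1015; 2936; 189; 1106; -1135; 2589; -910; 1118; -1373]);
  (10190, [:: 5004; -5327; 6003; 51; -6323; 10122; 3362; -2871; 225; -4654; -3836; -10183; 2453; 5672], [:: -1174; -298;
  -233; -51; 1283; -2937; 1376; 1559; -566; 757; -1128; -1324; 1477; -2363]);
  (12121, [:: -8369; 876; -4208; -863; 1599; -4615; 9060; 7325; -5148; -5457; 939; 570; 6685], [:: 2102; -418; 314;
  -136; -1117; -360; -1210; 2023; 1138; 2954; -691; -1700; 1129]);
  (12751, [:: 6370; -2382; -1018; 1808; 2650; 2058; -8374; 9192; 12736; 575; -4465; 2391], [:: -1752; -1040; 775; 134;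
  -1833; -1106; 2992; 1990; -391; -1900; -2472; -1526]);
  (13921, [:: -12157; 1439; -3910; -1494; 1452; -13646; 7557; -974; -10508; -9350; 6744], [:: 1459; -356; 646; 2245;
  -2028; 540; -473; -154; 1926; 1912; -301]);
  (14547, [:: -6554; 1047; -6893; 5571; -2294; 10158; 551; -2358; 12827; -5980], [:: 1245; 2014; 1915; -403; 565; 1883;
  1119; 2830; -1269; -394]);
  (15235, [:: -13405; 1328; -5784; -5814; -7951; 5806; 11738; 3883; 10726], [:: 1381; -946; 1926; 2034; 2411; 1690;
  -948; 1294; -2179]);
  (18947, [:: 14616; 6457; 16125; -11566; -16145; -13342; 4133; 10258], [:: -2022; -503; 47; -699; 2808; 1474; 2250;
  -1820]);
  (25506, [:: 11732; 24265; -25500; 5130; 176; -11093; -419], [:: -1423; -856; 1687; 11; -787; -710; 2669]);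
  (25596, [:: 17276; 4901; 9322; -21098; -19867; 8049], [:: -944; -1829; -1477; -1895; 1777; -2525]);
  (31033, [:: -15387; 818; -25324; 1; -16688], [:: 1665; -1651; 2199; -50; 0]);
  (31033, [:: -20357; -254; -23263; 257], [:: 39; 45; 1576; 2827]);
  (30787, [:: -30782; -30727; -30725], [:: 2994; 2998; 2999]);
  (61511, [:: -8; 61454], [:: 2999; 0]);
  (61511, [:: -61511], [:: 2999]);
  (123021, [::], [::])].

Lemma lu120_certified : certified 120 3317 1000 120 2999 lu120.
Proof. by vm_cast_no_check (erefl true). Qed.

End Data.

Section SmallOrders.
Variable R : realType.

(** One matrix per order: none of those of orders 11 to 14 has enough growth to serve the next order
    after bordering. For the same reason they miss the shifted bound c (n + 1), and the induction
    cannot start at 11. *)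
Lemma reach_11_15 n : (10 < n < 16)%N -> reach n (10045%:R / 10000%:R * n%:R : R).
Proof.
move=> nI.
have [->|n11] := eqVneq n 11; first exact: (certified_reach R lu11_certified).
have [->|n12] := eqVneq n 12; first exact: (certified_reach R lu12_certified).
have [->|n13] := eqVneq n 13; first exact: (certified_reach R lu13_certified).
have [->|n14] := eqVneq n 14; first exact: (certified_reach R lu14_certified).
have [->|n15] := eqVneq n 15; first exact: (certified_reach R lu15_certified).
by lia.
Qed.

(** Each target is the order of the next matrix, and 32 for the last one, so the blocks 16-17,
    18-19, 20-23, 24-27 and 28-31 tile a full range from N to 2 N - 1 with N = 16. *)
Lemma reach_16_31 n : (16 <= n < 32)%N ->
  reach n (10045%:R / 10000%:R * n.+1%:R : R).
Proof.
move=> nI.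
have [n18|n18] := ltnP n 18; first by apply: (certified_reach_range R lu16_certified); lia.
have [n20|n20] := ltnP n 20; first by apply: (certified_reach_range R lu18_certified); lia.
have [n24|n24] := ltnP n 24; first by apply: (certified_reach_range R lu20_certified); lia.
have [n28|n28] := ltnP n 28; first by apply: (certified_reach_range R lu24_certified); lia.
by apply: (certified_reach_range R lu28_certified); lia.
Qed.

End SmallOrders.

Local Open Scope ereal_scope.

Theorem theorem1p1 (R : realType) :
  (forall n : nat, (10 < n)%N ->
     ((10045%:R / 10000%:R) * n%:R : R)%:E <= gCP R n) /\
  ((3317%:R / 1000%:R : R)%:E <= limn_esup (fun n : nat => gCP R n * ((n%:R : R)^-1)%:E)).
Proof.
split; last first.
  (* The order is m = 120, with certified growth at least 3.317 * 120. *)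
  exact: reach_limn_esup (divr_ge0 (ler0n _ _) (ler0n _ _))
    (certified_reach R lu120_certified).
have c0 : (0 <= 10045%:R / 10000%:R :> R)%R := divr_ge0 (ler0n _ _) (ler0n _ _).
have := @reach_11_15 R; have := @reach_16_31 R.
(* The argument now holds for any c >= 0 that satisfies the two base ranges, so the numerals are
   abstracted away. *)
move: (10045%:R / 10000%:R)%R c0 => c c0 base small n n10.
apply: reach_gCP; [exact: ltn_trans n10 | exact: mulr_ge0 |].
case: (ltnP n 16) => n16; first by apply: small; rewrite n10.
(* From order 16 on, the shifted bound c (n + 1) is available and is weakened to c n. *)
by apply: reach_le (reach_linear _ c0 base n16); rewrite ?ler_wpM2l ?ler_nat.
Qed.
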